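(* Let $G$ be a centerless group with the weakly Howson property. Then: (1) $G\times\mathbb{Z}$ has $\mathrm{FGFP_a}$ if and only if $G$ has $\mathrm{FGFP_a}$ and $S\mathbb{Q}(G)\subset\Sigma^1(G)$; this last inclusion is equivalent to: every homomorphism $\alpha:G\to\mathbb{Z}$ has finitely generated kernel. (2) $G\times\mathbb{Z}^m$ has $\mathrm{FGFP_a}$ for every $m\geq 1$ if and only if $G$ has $\mathrm{FGFP_a}$ and $\Sigma^1(G)=S(G)$; this last equality is equivalent to: the derived subgroup $[G,G]$ is finitely generated.
   Context: A group is centerless if its center is trivial. A group $G$ has the weakly Howson property if $H\cap K$ is finitely generated for any two finitely generated subgroups $H,K<G$ such that one of $H$ and $K$ is normal in $G$. For an automorphism $\phi$ of a group $G$, $\mathrm{Fix}\,\phi=\{g\in G\mid \phi(g)=g\}$. A group $G$ has $\mathrm{FGFP_a}$ (the finitely generated fixed subgroup property of automorphisms) if $\mathrm{Fix}\,\phi$ is finitely generated for every $\phi\in\mathrm{Aut}(G)$; such a group is itself finitely generated (take $\phi=\mathrm{id}$). For a finitely generated group $G$ with finite generating set $X$: the character sphere is $S(G)=(\mathrm{Hom}(G,\mathbb{R})-\{0\})/\mathbb{R}_+$, whose elements are classes $[\chi]=\{r\chi\mid r\in\mathbb{R}_+\}$, with $\mathbb{R}_+$ the positive reals. Let $\Gamma=\Gamma(G,X)$ be the Cayley graph of $G$ with respect to $X$, and let $\Gamma_\chi$ be the subgraph of $\Gamma$ whose vertices are the $g\in G$ with $\chi(g)\geq 0$ and whose edges are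 those of $\Gamma$ connecting two such vertices. The BNS-invariant is $\Sigma^1(G)=\{[\chi]\in S(G)\mid \Gamma_\chi\text{ is connected}\}$. A non-trivial homomorphism $\chi:G\to\mathbb{R}$ is discrete if its image is discrete (hence infinite cyclic), and $S\mathbb{Q}(G)=\{[\chi]\in S(G)\mid \chi\text{ is discrete}\}$. *)

(* Defs.v *)
From HB Require Import structures.
From mathcomp Require Import all_boot all_order all_algebra.
From mathcomp Require Import all_classical all_reals all_analysis.
Import Order.TTheory GRing.Theory Num.Theory.
Import numFieldNormedType.Exports.

Set Implicit Arguments.
Unset Strict Implicit.
Unset Printing Implicit Defensive.

Local Open Scope classical_set_scope.
Local Open Scope ring_scope.
Local Open Scope group_scope.

(* The groups are arbitrary, possibly infinite, multiplicative [groupType]s;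
   a [zmodType] V is viewed as such through the library's
   [to_multiplicative V].  Subgroups are classical subsets of the carrier. *)

Section Groups.
Variable G : groupType.
Implicit Types (H K X : set G).

Definition is_subgroup H : Prop :=
  H 1 /\ (forall x y, H x -> H y -> H (x * y^-1)).

Definition generated X : set G := smallest is_subgroup X.

(* Implies that H is a subgroup. *)
Definition finitely_generated H : Prop :=
  exists2 X, finite_set X & H = generated X.

Definition finite_generating X : Prop :=
  finite_set X /\ generated X = [set: G].

Definition normal_subgroup H : Prop :=
  is_subgroup H /\ (forall g h, H h -> H (h ^ g)).

Definition group_center : set G := [set z | forall g, commute z g].

Definition centerless : Prop := group_center = [set 1].

Definition weakly_Howson : Prop :=
  forall H K, finitely_generated H -> finitely_generated K ->
    normal_subgroup H \/ normal_subgroup K -> finitely_generated (H `&` K).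

Definition Fix (phi : G -> G) : set G := [set g | phi g = g].

Definition FGFPa : Prop :=
  forall phi : {multiplicative G -> G},
    bijective phi -> finitely_generated (Fix phi).

Definition derived_subgroup : set G :=
  generated [set c | exists x y : G, c = [~ x, y]].

(* Edges g -- g * x for x in X, without orientation. *)
Definition cayley X : rel G :=
  [rel g h | (g^-1 * h \in X) || (h^-1 * g \in X)].

(* Connectedness of the full subgraph of (G, e) on the vertex set V. *)
Definition connected_on (e : rel G) (V : {pred G}) : Prop :=
  forall g h, g \in V -> h \in V ->
    exists p : seq G, [/\ path e g p, all [in V] p & last g p = h].

End Groups.

Definition group_hom (G : groupType) (V : zmodType) (f : G -> V) : Prop :=
  {morph f : g h / g * h >-> (g + h)%R}.

Definition hom_ker (G : groupType) (V : zmodType) (f : G -> V) : set G :=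
  f @^-1` [set 0%R].

Section Characters.
Variables (R : realType) (G : groupType).
Implicit Types (chi : G -> R) (X : set G).

Definition nonzero_hom : set (G -> R) :=
  [set chi | group_hom chi /\ chi <> cst 0%R].

Definition ray chi : set (G -> R) :=
  [set (fun g => r * chi g)%R | r in [set r : R | (0 < r)%R]].

Definition character_sphere : set (set (G -> R)) :=
  [set ray chi | chi in nonzero_hom].

(* The BNS invariant, computed in the Cayley graph of G with respect to X. *)
Definition Sigma1 X : set (set (G -> R)) :=
  [set ray chi | chi in
    nonzero_hom `&`
    [set chi | connected_on (cayley X) [pred g | (0 <= chi g)%R]]].

Definition discrete_hom chi : Prop := range chi `<=` isolated (range chi).

Definition SQ : set (set (G -> R)) :=
  [set ray chi | chi in nonzero_hom `&` [set chi | discrete_hom chi]].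

End Characters.

Arguments nonzero_hom R G _ : clear implicits.
Arguments character_sphere R G _ : clear implicits.
Arguments Sigma1 R {G} X _.
Arguments SQ R G _ : clear implicits.
Arguments group_center G _ : clear implicits.
Arguments centerless G : clear implicits.
Arguments weakly_Howson G : clear implicits.
Arguments FGFPa G : clear implicits.
Arguments derived_subgroup G _ : clear implicits.

(* Main.v *)
From HB Require Import structures.
Require Import Defs.
From mathcomp Require Import all_boot all_order all_algebra.
From mathcomp Require Import all_classical all_reals all_analysis.
From mathcomp Require Import generic_quotient zify lra.
Import Order.TTheory GRing.Theory Num.Theory.
Import numFieldNormedType.Exports.

(** The proof separates into two themes, linked by kernels of homomorphisms
    from G to free abelian groups.

    Fixed subgroups.  As G is centerless, the factor V = Z^m is the center of
    G x V, and an automorphism has the form (g, v) |-> (psi g, al g + L v).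
    Its fixed subgroup is finitely generated as soon as its projection to G
    is, and this projection is the intersection of Fix psi with the normal
    subgroup of all g with al g in the image of 1 - L.  If all homomorphisms
    from G to V have finitely generated kernels, then this normal subgroup is
    finitely generated, and the weakly Howson property concludes
    (FGFPa_prod).  Conversely, the automorphisms (g, v) |-> (g, v + f g) and psi x id show
    that finitely generated fixed subgroups in G x V force those of G and
    the kernel of each f : G -> V to be finitely generated
    (fg_hom_ker_of_FGFPa, FGFPa_factor).

    Sigma1 and kernels.  If the kernel of a character chi is finitely
    generated, then the half-space of chi is connected
    (connected_of_fg_ker), because paths that spell the generators of the
    kernel stay in it after a translation.  In the other direction, let
    al : G -> Z^m be a homomorphism such that the nonzero linear forms on the
    span of its values, composed with al, have connected half-spaces.  For a
    single character, connectedness yields a letter t and paths that push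
    every edge strictly upwards; this is an open condition, so by compactness
    of the sphere it holds with uniform constants (pushable_uniform).  Pushing
    in the direction - al g, the paths of the Cayley graph between elements g
    with al g small can be kept in a fixed ball (joined_sqnorm_below).  That
    ball is thus a connected graph.  A subgroup K of the kernel of al acts on
    it with finitely many orbits when each fiber of al meets finitely many
    cosets of K, and then K is finitely generated
    (fg_of_connected_half_spaces).

    For m = 1 and K = ker al this treats discrete characters, since these are
    the real multiples of integral ones (discrete_hom_int).  For the derived
    subgroup K one takes for al coordinates on the abelianization of G modulo
    torsion (coordinates_mod_derived).  The kernel of these coordinates is
    also contained in the kernel of every real character, so that finite
    generation of kernels for all Z^m passes to all real characters. *)

Set Implicit Arguments.
Unset Strict Implicit.
Unset Printing Implicit Defensive.

Local Open Scope classical_set_scope.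
Local Open Scope ring_scope.
Local Open Scope group_scope.

(** * Finitely generated subgroups and extensions *)

Section Subgroups.
Variable G : groupType.
Implicit Types (H K X : set G).

Lemma subgroup1 H : is_subgroup H -> H 1.
Proof. by case. Qed.

Lemma subgroupV H x : is_subgroup H -> H x -> H x^-1.
Proof. by move=> [H1 Hdiv] Hx; rewrite -[x^-1]mul1g; apply: Hdiv. Qed.

Lemma subgroupM H x y : is_subgroup H -> H x -> H y -> H (x * y).
Proof.
move=> sH Hx Hy; rewrite -[y]invgK; apply: sH.2 => //; exact: subgroupV.
Qed.

Lemma subgroupI H K : is_subgroup H -> is_subgroup K -> is_subgroup (H `&` K).
Proof.
move=> [H1 HV] [K1 KV]; split=> // x y [Hx Kx] [Hy Ky]; split; first exact: HV.
exact: KV.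
Qed.

Lemma sub_generated X : X `<=` generated X.
Proof. exact: sub_gen_smallest. Qed.

Lemma generated_sub X H : is_subgroup H -> X `<=` H -> generated X `<=` H.
Proof. by move=> sH XH x; apply; split. Qed.

Lemma generated_subgroup X : is_subgroup (generated X).
Proof.
split=> [H [[]]//|x y gx gy H /[dup] HX [sH XH]].
by apply: sH.2; [apply: gx|apply: gy].
Qed.

Lemma fg_subgroup H : finitely_generated H -> is_subgroup H.
Proof. by case=> X _ ->; apply: generated_subgroup. Qed.

Lemma finitely_generatedP H X : is_subgroup H -> finite_set X -> X `<=` H ->
  H `<=` generated X -> finitely_generated H.
Proof.
move=> sH fX XH HX; exists X => //; apply/seteqP; split => //.
exact: generated_sub.
Qed.

Lemma fg_set1 : finitely_generated [set (1 : G)].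
Proof.
exists [set 1] => //; apply/seteqP; split; first exact: sub_generated.
apply: generated_sub => //; split=> // x y -> ->; exact: mulgV.
Qed.

End Subgroups.

Section Morphisms.
Variables (G G' : groupType) (f : G -> G').
Hypothesis fM : {morph f : x y / x * y}.

Lemma morph1 : f 1 = 1.
Proof. by apply: (mulgI (f 1)); rewrite -fM !mulg1. Qed.

Lemma morphV : {morph f : x / x^-1}.
Proof. by move=> x; apply: (mulgI (f x)); rewrite -fM !mulgV morph1. Qed.

Lemma subgroup_preim H : is_subgroup H -> is_subgroup (f @^-1` H).
Proof.
move=> sH; split=> [|x y /= Hx Hy]; first by rewrite /= morph1; apply: sH.1.
by rewrite fM morphV; apply: sH.2.
Qed.

Lemma subgroup_image H : is_subgroup H -> is_subgroup (f @` H).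
Proof.
move=> sH; split=> [|_ _ [x Hx <-] [y Hy <-]].
  by exists 1; [exact: sH.1 | exact: morph1].
by exists (x * y^-1); [exact: sH.2 | rewrite fM morphV].
Qed.

Lemma image_generated X : f @` generated X = generated (f @` X).
Proof.
apply/seteqP; split.
  move=> _ [x gx <-]; apply: (gx (f @^-1` generated (f @` X))); split.
    by apply: subgroup_preim; apply: generated_subgroup.
  by move=> y Xy; apply: sub_generated; exists y.
apply: generated_sub; first by apply: subgroup_image; apply: generated_subgroup.
by move=> _ [x Xx <-]; exists x => //; apply: sub_generated.
Qed.

Lemma fg_image H : finitely_generated H -> finitely_generated (f @` H).
Proof.
move=> [X fX ->]; exists (f @` X); first exact: finite_image.
exact: image_generated.
Qed.

(** An extension is generated by lifts of generators of the quotient together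
    with generators of the kernel. *)
Lemma fg_extension H : is_subgroup H -> finitely_generated (f @` H) ->
  finitely_generated (H `&` f @^-1` [set 1]) -> finitely_generated H.
Proof.
move=> sH [Z fZ fHZ] [W fW kHW].
have /choice[s sP] : forall z, exists x, Z z -> H x /\ f x = z.
  move=> z.
  have [Zz|nZz] := pselect (Z z); last by exists (1 : G) => /nZz.
  have [x Hx <-] : (f @` H) z by rewrite fHZ; apply: sub_generated.
  by exists x.
apply: (@finitely_generatedP _ _ (s @` Z `|` W)) => [//||x|].
- by rewrite finite_setU; split=> //; apply: finite_image.
- move=> [[z Zz <-]|Ww]; first by case: (sP _ Zz).
  by have [] : (H `&` f @^-1` [set 1]) x by rewrite kHW; apply: sub_generated.
- set S := generated _; have sS : is_subgroup S by apply: generated_subgroup.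
  move=> h Hh; have : (f @` S) (f h).
    have : (f @` H) (f h) by exists h.
    rewrite fHZ image_generated; apply: generated_sub.
      exact: generated_subgroup.
    move=> z Zz; apply: sub_generated; exists (s z); last by case: (sP _ Zz).
    by left; exists z.
  move=> [h' Sh' fh'].
  have SH : S `<=` H.
    apply: generated_sub => // x [[z Zz <-]|Wx]; first by case: (sP _ Zz).
    have [] // : (H `&` f @^-1` [set 1]) x by rewrite kHW; apply: sub_generated.
  rewrite -(mulgVK h' h); apply: (subgroupM sS) => //.
  have : (H `&` f @^-1` [set 1]) (h * h'^-1).
    split; first by apply: sH.2 => //; apply: SH.
    by rewrite /= fM morphV fh' mulgV.
  rewrite kHW; apply: generated_sub => //.
  by move=> w Ww; apply: sub_generated; right.
Qed.

End Morphisms.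

(** * Homomorphisms to abelian groups *)

Section GroupHom.
Variables (G : groupType) (A : zmodType) (f : G -> A).
Hypothesis fM : group_hom f.
Local Open Scope ring_scope.

Lemma group_hom1 : f 1%g = 0.
Proof. by apply: (addrI (f 1%g)); rewrite -fM mulg1 addr0. Qed.

Lemma group_homV g : f g^-1%g = - f g.
Proof. by apply: (addrI (f g)); rewrite -fM mulgV subrr group_hom1. Qed.

Lemma group_homF g h : f (g * h^-1)%g = f g - f h.
Proof. by rewrite fM group_homV. Qed.

Lemma group_homX g n : f (g ^+ n)%g = f g *+ n.
Proof.
by elim: n => [|n IHn]; rewrite ?group_hom1// expgS fM IHn mulrS.
Qed.

Lemma group_homJ g h : f (g ^ h)%g = f g.
Proof. by rewrite conjgE !fM group_homV addrCA addNr addr0. Qed.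

Lemma group_homR g h : f [~ g, h]%g = 0.
Proof. by rewrite commgEl fM group_homV group_homJ addNr. Qed.

Lemma hom_preim_subgroup (P : set A) :
  P 0 -> (forall a b, P a -> P b -> P (a - b)) -> is_subgroup (f @^-1` P).
Proof.
move=> P0 PB; split=> [|x y /= Px Py]; first by rewrite /= group_hom1.
by rewrite group_homF; apply: PB.
Qed.

Lemma hom_ker_subgroup : is_subgroup (hom_ker f).
Proof.
by apply: hom_preim_subgroup => // a b -> ->; rewrite subrr.
Qed.

Lemma derived_sub_hom_ker : derived_subgroup G `<=` hom_ker f.
Proof.
apply: generated_sub; first exact: hom_ker_subgroup.
by move=> _ [x [y ->]]; apply: group_homR.
Qed.

(** Powers with integer exponents exist in a subgroup as far as their value
    under f is concerned, which is all that the arguments below use. *)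
Lemma hom_subgroup_mulz (H : set G) h (k : int) : is_subgroup H -> H h ->
  exists2 h', H h' & f h' = f h *~ k.
Proof.
move=> sH Hh; have Hn n : exists2 h', H h' & f h' = f h *+ n.
  exists (h ^+ n)%g; last exact: group_homX.
  elim: n => [|n IHn]; first exact: subgroup1.
  by rewrite expgS; apply: subgroupM.
case: k => n; first exact: Hn.
have [h' Hh' fh'] := Hn n.+1; exists h'^-1%g; first exact: subgroupV.
by rewrite group_homV fh'.
Qed.

End GroupHom.

Section IntegerSpan.
Local Open Scope ring_scope.

Lemma subrACA (A : zmodType) (a b c d : A) :
  (a - b) - (c - d) = (a - c) - (b - d).
Proof. by rewrite !opprD !opprK addrACA. Qed.

Lemma subset_mulz (A : zmodType) (P : set A) a (k : int) :
  P 0 -> (forall a b, P a -> P b -> P (a - b)) -> P a -> P (a *~ k).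
Proof.
move=> P0 PB Pa; have PN b : P b -> P (- b).
  by move=> Pb; rewrite -[- b]add0r; apply: PB.
have Pn n : P (a *+ n).
  elim: n => [//|n IHn]; rewrite mulrS -[a *+ n]opprK.
  by apply: PB => //; apply: PN.
by case: k => n; [exact: Pn | apply: PN; exact: Pn].
Qed.

Lemma int_subgroup_principal (J : set int) :
  J 0 -> (forall a b, J a -> J b -> J (a - b)) ->
  exists2 d, J d & forall k, J k -> exists q : int, k = d * q.
Proof.
move=> J0 Jsub.
have [exJ|nJ] := pselect (exists n : nat, `[< J n.+1%:Z >]); last first.
  have Jn (n : nat) : J n%:Z -> n = 0%N.
    by case: n => // n Jn; case: nJ; exists n; apply/asboolP.
  exists 0 => // k Jk; exists 0; rewrite mulr0.
  case: k Jk => [n /Jn->//|n Jk].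
  have /Jn // : J n.+1%:Z by rewrite -[_%:Z]opprK -NegzE -sub0r; apply: Jsub.
have [n /asboolP Jn nmin] := ex_minnP exJ; exists n.+1%:Z => // k Jk.
exists (k %/ n.+1)%Z; rewrite mulrC.
have Jr : J (k %% n.+1)%Z.
  rewrite /modz; apply: (Jsub) => //.
  by have := subset_mulz (k %/ n.+1)%Z J0 Jsub Jn; rewrite -mulrzl intz.
have r0 : 0 <= (k %% n.+1)%Z by apply: modz_ge0.
have rn : (k %% n.+1)%Z < n.+1 by apply: ltz_pmod.
rewrite {1}(divz_eq k n.+1).
case: (k %% n.+1)%Z Jr r0 rn => [[|r]|//]; first by rewrite addr0.
move=> Jr _; rewrite ltz_nat ltnS => rn.
by have := nmin r (asboolT Jr); rewrite leqNgt rn.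
Qed.

Variable A : zmodType.
Implicit Types (s : seq A) (a b : A).

(** The subgroup generated by a list, as a recursion: this is the filtration
    with cyclic quotients along which subgroups are shown to be finitely
    generated. *)
Fixpoint Zspan s : set A :=
  if s is x :: s' then [set a | exists k : int, Zspan s' (a - x *~ k)]
  else [set 0].

Lemma Zspan0 s : Zspan s 0.
Proof. by elim: s => //= x s IHs; exists 0; rewrite subr0. Qed.

Lemma ZspanB s a b : Zspan s a -> Zspan s b -> Zspan s (a - b).
Proof.
elim: s a b => [a b -> ->|x s IHs a b [k ka] [l lb]]; first exact: subrr.
by exists (k - l); rewrite mulrzBr subrACA; apply: IHs.
Qed.

Lemma mem_Zspan s a : a \in s -> Zspan s a.
Proof.
elim: s => //= x s IHs; rewrite inE => /predU1P[->|/IHs sa].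
  by exists 1; rewrite subrr; apply: Zspan0.
by exists 0; rewrite subr0.
Qed.

Lemma ZspanP s a : Zspan s a ->
  exists v : 'I_(size s) -> int, a = \sum_(i < size s) s`_i *~ v i.
Proof.
elim: s a => [a ->|x s IHs a /= [k /IHs[v va]]].
  by exists (fun=> 0); rewrite big_ord0.
exists (fun i => if unlift ord0 i is Some j then v j else k).
rewrite big_ord_recl unlift_none /=.
under eq_bigr do rewrite liftK.
by rewrite -va addrC subrK.
Qed.

End IntegerSpan.

Lemma hom_Zspan (G : groupType) (A : zmodType) (f : G -> A) (s : seq G) g :
  group_hom f -> generated [set` s] = [set: G] -> Zspan (map f s) (f g).
Proof.
move=> fM gs; have : generated [set` s] g by rewrite gs.
apply: (@generated_sub _ _ (f @^-1` Zspan (map f s))).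
  by apply: hom_preim_subgroup => //; [exact: Zspan0 | exact: ZspanB].
by move=> h sh; apply: mem_Zspan; apply: map_f.
Qed.

(** Every subgroup of a finitely generated abelian group is finitely generated,
    in the relative form where only the image of H is abelian.  The elements
    of H with image in the span of the tail form a subgroup H', finitely
    generated by induction; the coefficients on the head x form a subgroup
    d Z of Z, and H is generated by H' and one element with coefficient d. *)
Lemma fg_of_abelian_image (G : groupType) (A : zmodType) (f : G -> A)
    (s : seq A) (H : set G) :
  group_hom f -> is_subgroup H -> (forall h, H h -> Zspan s (f h)) ->
  finitely_generated (H `&` hom_ker f) -> finitely_generated H.
Proof.
move=> fM; elim: s H => [|x s IHs] H sH /= Hs kerH.
  suff <- : H `&` hom_ker f = H by [].
  by apply/seteqP; split=> [h []//|h Hh]; split=> //; apply: Hs.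
pose J := [set k : int | exists2 h, H h & Zspan s (f h - x *~ k)%R].
have [||d [h0 Hh0 h0s] Jd] := @int_subgroup_principal J.
- exists 1; first exact: subgroup1.
  by rewrite (group_hom1 fM) subrr; apply: Zspan0.
- move=> k l [g Hg gs] [h Hh hs]; exists (g * h^-1); first exact: sH.2.
  rewrite (group_homF fM) mulrzBr subrACA.
  exact: ZspanB.
pose H' := H `&` f @^-1` Zspan s.
have sH' : is_subgroup H'.
  apply: subgroupI => //; apply: hom_preim_subgroup => //; first exact: Zspan0.
  exact: ZspanB.
have [||Y fY H'Y] := IHs H' sH'.
- by move=> h [].
- suff -> : H' `&` hom_ker f = H `&` hom_ker f by [].
  rewrite /H'; apply/seteqP; split=> h [].
    by move=> [Hh _] fh.
  move=> Hh fh; split=> //; split=> //; rewrite /= fh; exact: Zspan0.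
apply: (@finitely_generatedP _ _ (h0 |` Y)) => //.
- by rewrite finite_setU.
- move=> g [->//|Yg]; have [] // : H' g.
  by rewrite H'Y; apply: sub_generated.
set S := generated _ => h Hh; have [k hk] := Hs h Hh.
have [|q kq] := Jd k; first by exists h.
have sS : is_subgroup S by exact: generated_subgroup.
have SH : S `<=` H.
  apply: generated_sub => // g [->//|Yg]; have [] // : H' g.
  by rewrite H'Y; apply: sub_generated.
have [|h1 Sh1 fh1] := hom_subgroup_mulz fM q sS (_ : S h0).
  by apply: sub_generated; left.
rewrite -(mulgVK h1 h); apply: (subgroupM sS) => //.
have : H' (h * h1^-1).
  split; first by apply: sH.2 => //; apply: SH.
  rewrite /= (group_homF fM) fh1.
  have -> : (f h - f h0 *~ q = (f h - x *~ k) - (f h0 - x *~ d) *~ q)%R.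
    by rewrite kq mulrzBl -mulrzA opprB addrA subrK.
  apply: ZspanB => //; apply: subset_mulz => //; [exact: Zspan0|exact: ZspanB].
rewrite H'Y; apply: generated_sub => // g Yg.
by apply: sub_generated; right.
Qed.

(** * The abelianization *)

Section Abelianization.
Variable G : groupType.
Local Notation D := (derived_subgroup G).

Lemma derived_subgroupP : is_subgroup D.
Proof. exact: generated_subgroup. Qed.

Lemma derivedR g h : D [~ g, h].
Proof. by apply: sub_generated; exists g, h. Qed.

Lemma derivedJ g h : D h -> D (h ^ g).
Proof.
move=> Dh; have -> : h ^ g = h * [~ h, g] by rewrite commgEl mulVKg.
by apply: (subgroupM derived_subgroupP) => //; apply: derivedR.
Qed.

Definition eq_mod_derived : rel G := [rel g h | `[< D (g * h^-1) >]].

Lemma eq_mod_derived_equiv : equiv_class_of eq_mod_derived.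
Proof.
have sD := derived_subgroupP.
split=> [g|g h|h g k].
- by apply/asboolP; rewrite mulgV; apply: sD.1.
- by apply: asbool_equiv_eq; split=> /(subgroupV sD); rewrite invgF.
- move=> /asboolP gh /asboolP hk; apply/asboolP.
  by rewrite -(divgKA h g k^-1); apply: (subgroupM sD).
Qed.

Canonical eq_mod_derived_equiv_rel := EquivRelPack eq_mod_derived_equiv.

Definition abelianization := {eq_quot eq_mod_derived}%qT.
HB.instance Definition _ := Choice.on abelianization.
HB.instance Definition _ := EqQuotient.on abelianization.

Definition ab (g : G) : abelianization := (\pi_abelianization g)%qT.

Lemma ab_eqP g h : ab g = ab h <-> D (g * h^-1).
Proof.
split=> [/eqP|gh]; first by rewrite /ab piE => /asboolP.
by apply/eqP; rewrite /ab piE; apply/asboolP.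
Qed.

Lemma abK (a : abelianization) : ab (repr a) = a.
Proof. exact: reprK. Qed.

Definition ab_add (a b : abelianization) : abelianization :=
  ab (repr a * repr b).
Definition ab_opp (a : abelianization) : abelianization := ab (repr a)^-1.

Lemma abM g h : ab (g * h) = ab_add (ab g) (ab h).
Proof.
apply/ab_eqP; rewrite invgM.
set g' := repr (ab g); set h' := repr (ab h).
have gg' : D (g * g'^-1) by apply/ab_eqP; rewrite abK.
have hh' : D (h * h'^-1) by apply/ab_eqP; rewrite abK.
have -> : g * h * (h'^-1 * g'^-1) = (h * h'^-1) ^ g^-1 * (g * g'^-1).
  by rewrite conjgE invgK !mulgA mulgVK.
by apply: (subgroupM derived_subgroupP) => //; apply: derivedJ.
Qed.

Lemma ab_addA : associative ab_add.
Proof.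
by move=> a b c; rewrite -[a]abK -[b]abK -[c]abK -!abM mulgA.
Qed.

Lemma ab_addC : commutative ab_add.
Proof.
move=> a b; apply/ab_eqP; rewrite invgM.
set g := repr a; set h := repr b.
have -> : g * h * (g^-1 * h^-1) = [~ g^-1, h^-1].
  by rewrite commgEl conjgE !invgK !mulgA.
exact: derivedR.
Qed.

Lemma ab_add0 : left_id (ab 1) ab_add.
Proof. by move=> a; rewrite -[a]abK -abM mul1g. Qed.

Lemma ab_addN : left_inverse (ab 1) ab_opp ab_add.
Proof. by move=> a; rewrite -{2}[a]abK -abM mulVg. Qed.

HB.instance Definition _ :=
  GRing.isZmodule.Build abelianization ab_addA ab_addC ab_add0 ab_addN.

Lemma ab_hom : group_hom ab.
Proof. exact: abM. Qed.

Lemma hom_ker_ab : hom_ker ab = D.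
Proof.
apply/seteqP; split=> g; rewrite /hom_ker/=.
  by move=> /ab_eqP; rewrite divg1.
by move=> Dg; apply/ab_eqP; rewrite divg1.
Qed.

End Abelianization.

(** The quotient of H by the kernel is a subgroup of a finitely generated
    abelian group. *)
Lemma fg_overgroup_hom_ker (G : groupType) (A : zmodType) (f : G -> A) H :
  group_hom f -> finitely_generated [set: G] -> is_subgroup H ->
  hom_ker f `<=` H -> finitely_generated (hom_ker f) -> finitely_generated H.
Proof.
move=> fM [X /finite_seqP[s ->] gX] sH kH fgk.
apply: (fg_of_abelian_image (s := map f s) fM) => //.
  by move=> h _; apply: hom_Zspan.
by rewrite setIidr.
Qed.

Lemma fg_hom_ker_of_derived (G : groupType) (A : zmodType) (f : G -> A) :
  group_hom f -> finitely_generated [set: G] ->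
  finitely_generated (derived_subgroup G) -> finitely_generated (hom_ker f).
Proof.
move=> fM fgG; rewrite -hom_ker_ab => fgD.
apply: (fg_overgroup_hom_ker (@ab_hom G)) => //; first exact: hom_ker_subgroup.
by rewrite hom_ker_ab; apply: derived_sub_hom_ker.
Qed.

(** * Automorphisms of the product with an abelian group *)

Section ProductWithAbelian.
Variables (G : groupType) (V : zmodType).
Local Notation GV := (G * Algebra.to_multiplicative V)%type.

Lemma FGFPa_morph (H : groupType) (phi : H -> H) : FGFPa H ->
  {morph phi : x y / x * y} -> bijective phi -> finitely_generated (Fix phi).
Proof.
move=> fgH phiM phi_bij.
pose m := isMultiplicative.Build H H phi phiM.
pose p : {multiplicative H -> H} := HB.pack phi m.
exact: (fgH p).
Qed.

Lemma Fix_subgroup (H : groupType) (phi : H -> H) :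
  {morph phi : x y / x * y} -> is_subgroup (Fix phi).
Proof.
move=> phiM; split=> [|x y]; rewrite /Fix/=; first exact: (morph1 phiM).
by move=> px py; rewrite phiM (morphV phiM) px py.
Qed.

Lemma FGFPa_fg (H : groupType) : FGFPa H -> finitely_generated [set: H].
Proof.
move=> fgH; suff <- : Fix (@id H) = [set: H].
  by apply: FGFPa_morph => //; exists id.
by apply/seteqP; split.
Qed.

Lemma fstM : {morph (fst : GV -> G) : p q / p * q}.
Proof. by []. Qed.

Lemma sndM : group_hom (snd : GV -> V).
Proof. by []. Qed.

Lemma FGFPa_factor : FGFPa GV -> FGFPa G.
Proof.
move=> fgGV phi [psi phiK psiK].
pose Phi (p : GV) : GV := (phi p.1, p.2).
suff <- : fst @` Fix Phi = Fix phi.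
  apply: (fg_image fstM); apply: FGFPa_morph => //.
    by move=> p q; rewrite /Phi /= gmulfM.
  exists (fun p : GV => (psi p.1, p.2)) => -[g v]; rewrite /Phi/=.
    by rewrite phiK.
  by rewrite psiK.
apply/seteqP; split=> [_ [[g v] [gE] <-]//|g phig].
by exists (g, 0%R) => //; rewrite /Fix/Phi/= phig.
Qed.

(** The transvection (g, v) |-> (g, v + f g) fixes exactly the pairs over the
    kernel of f. *)
Lemma fg_hom_ker_of_FGFPa (f : G -> V) :
  FGFPa GV -> group_hom f -> finitely_generated (hom_ker f).
Proof.
move=> fgGV fM.
pose Phi (p : GV) : GV := (p.1, (p.2 + f p.1)%R).
suff <- : fst @` Fix Phi = hom_ker f.
  apply: (fg_image fstM); apply: FGFPa_morph => //.
    by move=> p q; rewrite /Phi/= fM; congr pair; apply: addrACA.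
  exists (fun p : GV => (p.1, (p.2 - f p.1)%R)) => -[g v]; rewrite /Phi/=.
    by rewrite addrK.
  by rewrite subrK.
apply/seteqP; split=> [_ [[g v] [gv] <-]|g fg].
  by apply: (addrI v); rewrite gv addr0.
by exists (g, 0%R) => //; rewrite /Fix/Phi/= fg addr0.
Qed.

(** Since G is centerless the factor V is the center of the product, so every
    automorphism preserves it and has the triangular shape
    (g, v) |-> (psi g, al g + L v) with psi an automorphism of G. *)
Section Automorphism.
Variable phi : GV -> GV.
Hypotheses (phiM : {morph phi : p q / p * q}) (phi_bij : bijective phi).
Hypothesis Gcenterless : centerless G.

Let psi g := (phi (g, 0%R)).1.
Let al g : V := (phi (g, 0%R)).2.
Let L v : V := (phi (1, v)).2.

Lemma central_pairP (p : GV) : (forall q, commute p q) <-> p.1 = 1.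
Proof.
split=> [cp|p1 q].
  have : group_center G p.1 by move=> g; have [] := cp (g, 0%R).
  by rewrite Gcenterless.
by case: p p1 => _ v /= ->; rewrite /commute /=; congr pair;
  [rewrite mul1g mulg1 | apply: addrC].
Qed.

Lemma aut_central (p : GV) : (phi p).1 = 1 <-> p.1 = 1.
Proof.
case: phi_bij => phi' phiK phi'K; rewrite -!central_pairP; split=> cp q.
  apply: (can_inj phiK); rewrite !phiM; exact: cp.
by rewrite -(phi'K q) /commute -!phiM cp.
Qed.

Lemma aut_prodE g v : phi (g, v) = (psi g, (al g + L v)%R).
Proof.
have -> : (g, v) = ((g, 0%R) : GV) * (1, v).
  by congr pair; [rewrite mulg1 | symmetry; apply: add0r].
rewrite phiM; congr pair => /=.
by rewrite (_ : (phi (1, v)).1 = 1) ?mulg1//; apply/aut_central.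
Qed.

Lemma aut_fstM : {morph psi : g h / g * h}.
Proof.
move=> g h; rewrite /psi.
have -> : (g * h, 0%R) = ((g, 0%R) : GV) * (h, 0%R).
  by congr pair; symmetry; apply: addr0.
by rewrite phiM.
Qed.

Lemma aut_sndM : group_hom al.
Proof.
move=> g h; rewrite /al.
have -> : (g * h, 0%R) = ((g, 0%R) : GV) * (h, 0%R).
  by congr pair; symmetry; apply: addr0.
by rewrite phiM.
Qed.

Lemma aut_fst_bij : bijective psi.
Proof.
case: (phi_bij) => phi' phiK phi'K.
have psi_inj : injective psi.
  move=> g h gh; apply: divg1_eq; apply/(aut_central (g * h^-1, 0%R)).
  have := aut_fstM g h^-1; rewrite /psi => ->.
  by rewrite -/(psi _) -/(psi _) (morphV aut_fstM) gh mulgV.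
have psiK : cancel (fun g => (phi' (g, 0%R)).1) psi.
  move=> g; have := phi'K (g, 0%R).
  by case: (phi' _) => h v; rewrite aut_prodE => -[].
exists (fun g => (phi' (g, 0%R)).1) => //.
by move=> g; apply: psi_inj; rewrite psiK.
Qed.

Lemma fst_Fix : fst @` Fix phi =
  Fix psi `&` al @^-1` range (fun v => v - L v)%R.
Proof.
apply/seteqP; split.
  move=> _ [[g v] fgv <-]; move: fgv; rewrite /Fix/= aut_prodE => -[gE vE].
  by split=> //; exists v => //; rewrite -{1}vE addrK.
move=> g [psig [v _ vE]]; exists (g, v) => //.
by rewrite /Fix/= aut_prodE psig -vE subrK.
Qed.

Lemma aut_on_centerB : {morph L : v w / (v - w)%R}.
Proof.
move=> v w; have LM : {morph L : v w / (v + w)%R}.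
  move=> x y; rewrite /L.
  have -> : (1, (x + y)%R) = ((1, x) : GV) * (1, y).
    by congr pair; rewrite mulg1.
  by rewrite phiM.
by apply: (addIr (L w)); rewrite -LM !subrK.
Qed.

End Automorphism.

(** The fixed subgroup of (g, v) |-> (psi g, al g + L v) is an extension: its
    projection to G consists of the fixed points g of psi for which al g lies
    in the image of 1 - L, and the kernel of this projection is a subgroup of
    V.  The condition on al g cuts out a normal subgroup, which contains the
    kernel of al and is therefore finitely generated, and this is where the
    weakly Howson property enters. *)
Lemma FGFPa_prod (s : seq V) :
  centerless G -> weakly_Howson G -> FGFPa G -> (forall v, Zspan s v) ->
  (forall f : G -> V, group_hom f -> finitely_generated (hom_ker f)) ->
  FGFPa GV.
Proof.
move=> Gcl GwH fgG sV fgker phi phi_bij.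
have phiM : {morph phi : p q / p * q} by exact: gmulfM.
pose al g : V := (phi (g, 0%R)).2; pose L v : V := (phi (1, v)).2.
pose W := range (fun v => v - L v)%R.
have alM : group_hom al by exact: aut_sndM.
have LB : {morph L : v w / (v - w)%R} := aut_on_centerB phiM.
have L0 : L 0%R = 0%R by have := LB 0%R 0%R; rewrite !subrr.
have W0 : W 0%R by exists 0%R => //; rewrite L0 subrr.
have sW : is_subgroup (al @^-1` W).
  apply: hom_preim_subgroup => // _ _ [v _ <-] [w _ <-].
  by exists (v - w)%R => //; rewrite LB subrACA.
apply: (fg_extension fstM) => //; first exact: Fix_subgroup.
- rewrite (fst_Fix phiM phi_bij Gcl); apply: GwH.
  + apply: FGFPa_morph => //; [exact: aut_fstM | exact: aut_fst_bij].
  + apply: (fg_of_abelian_image alM sW) => [h _|]; first exact: sV.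
    rewrite setIidr; first exact: fgker.
    by move=> g; rewrite /hom_ker/= => ->.
  + right; split=> // g h.
    rewrite -[_ h]/(W (al h)) -[_ (h ^ g)]/(W (al (h ^ g))).
    by rewrite (group_homJ alM).
- apply: (fg_of_abelian_image (s := s) sndM) => [|h _|].
  + apply: subgroupI; first exact: Fix_subgroup.
    by apply: (subgroup_preim fstM); exact/fg_subgroup/fg_set1.
  + exact: sV.
  + rewrite (_ : _ `&` _ = [set 1]); first exact: fg_set1.
    apply/seteqP; split=> [[g v] [[_]]|_ ->].
      by rewrite /hom_ker/= => -> ->.
    by split=> //; split=> //; exact: (morph1 phiM).
Qed.

End ProductWithAbelian.

(** * Connectedness in Cayley graphs *)

Section Cayley.
Variables (G : groupType) (X : set G).
Implicit Types (B : set G) (g h k : G).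

(** The existence of a path all of whose vertices, both endpoints included, lie
    in B.  Paths are extended on the right, as words are. *)
Inductive joined B g : G -> Prop :=
| joined_refl : B g -> joined B g g
| joined_step h k : joined B g h -> cayley X h k -> B k -> joined B g k.

Lemma cayleyC g h : cayley X g h = cayley X h g.
Proof. by rewrite /cayley/= orbC. Qed.

Lemma cayley_mull z g h : cayley X (z * g) (z * h) = cayley X g h.
Proof. by rewrite /cayley/= !invgM !mulgA !mulgVK. Qed.

Lemma cayley_mulr g h : cayley X g (g * h) = cayley X 1 h.
Proof. by rewrite -{1}[g]mulg1 cayley_mull. Qed.

Lemma joined_memr B g h : joined B g h -> B h.
Proof. by case. Qed.

Lemma joined_trans B g h k : joined B g h -> joined B h k -> joined B g k.
Proof.
by move=> gh; elim=> // k' l _ gk' k'l Bl; apply: joined_step k'l Bl.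
Qed.

Lemma joined_edge B g h : cayley X g h -> B g -> B h -> joined B g h.
Proof. by move=> gh Bg Bh; apply: joined_step gh Bh; apply: joined_refl. Qed.

Lemma joined_sym B g h : joined B g h -> joined B h g.
Proof.
elim=> [|k l gk kg kl Bl]; first exact: joined_refl.
apply: joined_trans kg; apply: joined_edge => //; first by rewrite cayleyC.
exact: joined_memr gk.
Qed.

Lemma joined_mul B B' z g h :
  (forall x, B x -> B' (z * x)) -> joined B g h -> joined B' (z * g) (z * h).
Proof.
move=> BB'; elim=> [Bg|k l _ IH kl Bl]; first by apply: joined_refl; apply: BB'.
by apply: joined_step IH _ _; [rewrite cayley_mull | apply: BB'].
Qed.

Lemma joined_sub B B' g h : B `<=` B' -> joined B g h -> joined B' g h.
Proof.
by move=> BB'; rewrite -{2}[g]mul1g -{2}[h]mul1g; apply: joined_mul => x;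
  rewrite mul1g; apply: BB'.
Qed.

Lemma connected_onP (V : {pred G}) :
  connected_on (cayley X) V <->
  forall g h, g \in V -> h \in V -> joined [set` V] g h.
Proof.
split=> cV g h gV hV; last first.
  have := cV g h gV hV; elim=> [_|k l _ [p [gp pV pk]] kl Vl].
    by exists [::].
  exists (rcons p l); split; last by rewrite last_rcons.
    by rewrite rcons_path gp pk.
  by rewrite all_rcons pV andbT.
have [p [gp pV <-]] := cV g h gV hV; move: gp pV {cV hV h}.
elim/last_ind: p => [_ _|p k IHp]; first exact: joined_refl.
rewrite rcons_path all_rcons last_rcons => /andP[gp pk] /andP[Vk pV].
by apply: joined_step pk _ => //; apply: IHp.
Qed.

Lemma joined_total g h : generated X = [set: G] -> joined setT g h.
Proof.
move=> gX; have : [set: G] (g^-1 * h) by [].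
have J1 k : joined setT 1 k -> joined setT g (g * k).
  by rewrite -{1}[g]mulg1; apply: joined_mul.
rewrite -{2}(mulVKg g h) => gh; apply: J1; move: gh; rewrite -{1}gX.
apply: (@generated_sub _ _ (joined setT 1)).
  split=> [|x y jx jy]; first exact: joined_refl.
  apply: joined_trans jx _; apply: joined_sym.
  rewrite -[x * _]mulg1 -{2}(mulgVK y x).
  by apply: joined_mul jy.
move=> x Xx; apply: joined_edge => //.
by apply/orP; left; rewrite invg1 mul1g inE.
Qed.

(** A group acting with finitely many orbits of vertices on a connected graph
    of finite valency is finitely generated: along a path from 1 to n in N,
    choose representatives t of the orbits met, and the quotients t y s^-1 of
    consecutive choices multiply to n. *)
Lemma fg_of_connected_orbits (N B T : set G) : finite_set X ->
  is_subgroup N -> N `<=` B -> finite_set T ->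
  (forall g, B g -> exists2 t, T t & N (g * t^-1)) ->
  (forall g, B g -> joined B 1 g) -> finitely_generated N.
Proof.
move=> fX sN NB fT BT Bconn.
(* Adding 1 to T lets a path start and end at the representative 1; adding 1
   to Y makes the starting element t^-1 a generator. *)
pose T1 := 1 |` T; pose Y := 1 |` (X `|` [set x^-1 | x in X]).
pose S := N `&` [set p.1.1 * p.1.2 * p.2^-1 | p in (T1 `*` Y) `*` T1].
have fT1 : finite_set T1 by rewrite finite_setU.
have SN t y s : T1 t -> Y y -> T1 s -> N (t * y * s^-1) ->
    generated S (t * y * s^-1).
  by move=> Tt Yy Ts Nn; apply: sub_generated; split=> //; exists ((t, y), s).
have sS : is_subgroup (generated S) by exact: generated_subgroup.
apply: (@finitely_generatedP _ _ S) => //.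
- apply: finite_setIr; apply: finite_image; do !apply: finite_setX => //.
  by rewrite !finite_setU; do !split=> //; apply: finite_image.
- by move=> n [].
have main h : joined B 1 h -> forall t, T1 t -> N (h * t^-1) ->
    generated S (h * t^-1).
  elim=> [_ t Tt Nt|k l jk IH kl Bl s Ts Ns].
    by rewrite -[1]mulg1; apply: SN => //; [left|left|rewrite mulg1].
  have [t Tt Nt] := BT k (joined_memr jk).
  have {}IH := IH t (or_intror Tt) Nt.
  have E : (k * t^-1)^-1 * (l * s^-1) = t * (k^-1 * l) * s^-1.
    by rewrite invgM invgK !mulgA.
  rewrite -(mulVKg (k * t^-1) (l * s^-1)); apply: (subgroupM sS) => //.
  rewrite E; apply: SN => //; first by right.
  + case/orP: kl; rewrite inE => Xkl; right; first by left.
    by right; exists (l^-1 * k) => //; rewrite invgM invgK.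
  + by rewrite -E; apply: (subgroupM sN) => //; exact: subgroupV.
move=> n Nn; rewrite -(divg1 n); apply: main; first exact/Bconn/NB.
  by left.
by rewrite divg1.
Qed.

End Cayley.

(** * Half-spaces of a character with finitely generated kernel *)

Section Characters.
Variables (R : realType) (G : groupType) (X : set G) (chi : G -> R).
Hypotheses (gX : finite_generating X) (chiM : group_hom chi).
Local Open Scope ring_scope.

Lemma exists_ascending : chi <> cst 0 ->
  exists2 t, cayley X 1%g t & 0 < chi t.
Proof.
move=> chi0; apply: contrapT => nt; apply: chi0.
have X0 x : cayley X 1%g x -> chi x = 0.
  move=> Xx; apply/eqP; rewrite eq_le !leNgt.
  apply/andP; split; apply/negP => xpos; apply: nt; first by exists x.
  exists x^-1%g; last by rewrite (group_homV chiM) oppr_gt0.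
  by rewrite -(cayley_mull _ x) mulg1 mulgV cayleyC.
apply/funext => g /=; have : generated X g by rewrite gX.2.
apply: (@generated_sub _ _ (hom_ker chi)); first exact: hom_ker_subgroup.
move=> x Xx; apply: X0; apply/orP; left.
by rewrite invg1 mul1g inE.
Qed.

Lemma joined_bounded B g h : joined X B g h ->
  exists M : R, joined X (B `&` [set p | M <= chi p]) g h.
Proof.
elim=> [Bg|k l _ [M jM] kl Bl].
  by exists (chi g); apply: joined_refl => /=.
exists (Num.min M (chi l)); apply: joined_step kl _; last first.
  by split=> //=; rewrite ge_min lexx orbT.
by apply: joined_sub jM => p [Bp Mp]; split=> //=; rewrite ge_min Mp.
Qed.

Local Notation upper c := [set p | c <= chi p].

Lemma joined_upper_mul (c : R) d z g h : d <= chi z + c ->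
  joined X (upper c) g h -> joined X (upper d) (z * g)%g (z * h)%g.
Proof.
move=> dc; apply: joined_mul => x /= cx; rewrite chiM.
by rewrite (le_trans dc)// lerD2l.
Qed.

(** Paths in the Cayley graph that spell the finitely many generators of the
    kernel K descend by a bounded amount, so after translation by a high power
    of an ascending letter t they stay in the half-space.  Hence t^m is joined
    to t^m k for every k in K, and by normality 1 is joined to every element
    of K.  A general g has the form k h with k in K, where h is
    spelled by the letters of a word for g, those that do not descend first,
    and is thus joined to 1. *)
Lemma connected_of_fg_ker : chi <> cst 0 -> finitely_generated (hom_ker chi) ->
  forall g, 0 <= chi g -> joined X (upper 0) 1%g g.
Proof.
move=> chi0 [Z fZ kerZ].
have [t Xt t_gt0] := exists_ascending chi0.
have [M ZM] : exists M : R, forall z, Z z -> joined X (upper M) 1%g z.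
  move/finite_seqP : fZ => [s ->].
  elim: s => [|z s [M sM]]; first by exists 0.
  have [M' zM'] := joined_bounded (joined_total 1%g z gX.2).
  exists (Num.min M M') => y /=; rewrite inE => /predU1P[->|ys].
    by apply: joined_sub zM' => p [_ /=]; rewrite ge_min => ->; rewrite orbT.
  by apply: joined_sub (sM y ys) => p /=; rewrite ge_min => ->.
have [m mM] : exists m, - M <= chi (t ^+ m)%g.
  exists (Num.bound `|- M / chi t|); rewrite (group_homX chiM) -mulr_natr.
  rewrite mulrC -ler_pdivrMr//; apply: le_trans (ler_norm _) _.
  by apply: ltW; apply: archi_boundP.
have t1 : joined X (upper 0) 1%g (t ^+ m)%g.
  elim: (m) => [|n IHn].
    by apply: joined_refl; rewrite /= (group_hom1 chiM).
  rewrite expgSr; apply: joined_step IHn _ _; first by rewrite cayley_mulr.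
  by rewrite /= -expgSr (group_homX chiM) mulrn_wge0// ltW.
have tK k : hom_ker chi k -> joined X (upper 0) (t ^+ m)%g (t ^+ m * k)%g.
  pose S := hom_ker chi `&`
    [set k | joined X (upper 0) (t ^+ m)%g (t ^+ m * k)%g].
  suff KS : hom_ker chi `<=` S by move=> /KS[].
  rewrite {1}kerZ; apply: generated_sub.
    have sK := hom_ker_subgroup chiM.
    split; first by split; [exact: sK.1|rewrite /= mulg1; apply: joined_refl;
      exact: joined_memr t1].
    move=> x y [Kx jx] [Ky jy]; split; first exact: sK.2.
    apply: joined_trans jx _; apply: joined_sym.
    pose z := (t ^+ m * (x * y^-1) * (t ^+ m)^-1)%g.
    have z0 : 0 <= chi z + 0.
      rewrite addr0 (group_homF chiM) chiM (group_homF chiM).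
      by rewrite [chi x]Kx [chi y]Ky subr0 addr0 subrr.
    by have := joined_upper_mul z0 jy; rewrite /z mulgVK !mulgA !mulgVK.
  move=> z Zz; split; first by rewrite kerZ; apply: sub_generated.
  have := @joined_upper_mul M 0 (t ^+ m)%g _ _ _ (ZM z Zz).
  by rewrite /= mulg1; apply; rewrite -lerBlDr sub0r.
(* With k' = k ^ (t ^+ m) the path from t^m to t^m k' = k t^m is closed up by
   the path from 1 to t^m and its translate by k. *)
have joinK k : hom_ker chi k -> joined X (upper 0) 1%g k.
  move=> Kk; apply: (joined_trans t1).
  apply: joined_trans (tK (k ^ (t ^+ m))%g _) _.
    by rewrite /hom_ker/= (group_homJ chiM).
  rewrite mulgA mulgV mul1g; apply: joined_sym.
  rewrite -{1}[k]mulg1; apply: joined_upper_mul t1.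
  by rewrite (Kk : _ = 0) addr0.
have split_word g : exists a b, [/\ joined X (upper 0) 1%g a,
    joined X (upper (chi b)) 1%g b & chi g = chi a + chi b].
  elim: (joined_total 1%g g gX.2) => [_|k l _ [a [b [ja jb kab]]] kl _].
    have j1 : joined X (upper 0) 1%g 1%g.
      by apply: joined_refl; rewrite /= (group_hom1 chiM).
    by exists 1%g, 1%g; rewrite (group_hom1 chiM) addr0.
  have [y ly] : exists y, l = (k * y)%g by exists (k^-1 * l)%g; rewrite mulVKg.
  have y1 : cayley X 1%g y by rewrite -(cayley_mulr _ k) -ly.
  have [y_ge0|y_lt0] := leP 0 (chi y).
    exists (a * y)%g, b; split=> //; last by rewrite ly !chiM kab addrAC.
    apply: (joined_step ja); first by rewrite cayley_mulr.
    by rewrite /= chiM addr_ge0//; exact: (joined_memr ja).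
  exists a, (b * y)%g; split=> //; last by rewrite ly !chiM kab addrA.
  apply: (@joined_step _ _ _ _ b); rewrite ?cayley_mulr//=.
  apply: joined_sub jb => p /=; apply: le_trans.
  by rewrite chiM gerDl ltW.
move=> g g_ge0; have [a [b [ja jb gab]]] := split_word g.
have jab : joined X (upper 0) 1%g (a * b)%g.
  apply: (joined_trans ja); rewrite -{1}[a]mulg1.
  by apply: joined_upper_mul jb; rewrite -gab.
have Kk : hom_ker chi (g * (a * b)^-1)%g.
  by rewrite /hom_ker/= (group_homF chiM) gab chiM subrr.
apply: (joined_trans (joinK _ Kk)).
rewrite -{2}(mulgVK (a * b)%g g) -{1}[(g * _)%g]mulg1.
by apply: joined_upper_mul jab; rewrite (Kk : _ = 0) addr0.
Qed.

End Characters.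

(** * The integral lattice and its real characters *)

Lemma leq_sqr n : (n <= n ^ 2)%N.
Proof. by case: n => // n; rewrite -mulnn leq_pmulr. Qed.

Section LatticePairing.
Variables (R : realType) (m : nat).
Implicit Types (u : 'rV[R]_m) (a b : 'rV[int]_m).
Local Open Scope ring_scope.

Definition pairing u a : R := \sum_i u 0 i * (a 0 i)%:~R.

Definition sqnorm a : nat := (\sum_i `|a 0%R i| ^ 2)%N.

Lemma pairingD u a b : pairing u (a + b) = pairing u a + pairing u b.
Proof.
by rewrite -big_split; apply: eq_bigr => i _; rewrite mxE intrD mulrDr.
Qed.

Lemma pairingBl u v a : pairing (u - v) a = pairing u a - pairing v a.
Proof. by rewrite -sumrB; apply: eq_bigr => i _; rewrite !mxE mulrBl. Qed.

Lemma pairingZl c u a : pairing (c *: u) a = c * pairing u a.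
Proof. by rewrite mulr_sumr; apply: eq_bigr => i _; rewrite mxE mulrA. Qed.

Lemma sqnormE a : (sqnorm a)%:R = \sum_i ((a 0 i)%:~R : R) ^+ 2.
Proof.
rewrite natr_sum; apply: eq_bigr => i _.
by rewrite natrX natr_absz intr_norm real_normK// num_real.
Qed.

Lemma sqnormD a b : (sqnorm (a + b))%:R =
  (sqnorm a)%:R + 2 * pairing (map_mx intr a) b + (sqnorm b)%:R :> R.
Proof.
rewrite !sqnormE mulr_sumr -!big_split; apply: eq_bigr => i _ /=.
by rewrite !mxE intrD sqrrD mulr_natl.
Qed.

Lemma coord_le_norm u i : `|u 0 i| <= `|u|.
Proof.
rewrite [leRHS]/Num.norm /= mx_normrE.
exact: (le_bigmax _ (fun ij => `|u ij.1 ij.2|) (0, i)).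
Qed.

(** The norm of u is the maximum norm, so the bound holds with the sum of the
    absolute values of the coordinates of a, and |n| <= n^2 for integers. *)
Lemma pairing_bound u a : `|pairing u a| <= `|u| * (sqnorm a)%:R.
Proof.
apply: le_trans (ler_norm_sum _ _ _) _.
rewrite sqnormE mulr_sumr; apply: ler_sum => i _; rewrite normrM.
apply: ler_pM => //; first exact: coord_le_norm.
rewrite -real_normK ?num_real// -intr_norm -natr_absz -natrX ler_nat.
exact: leq_sqr.
Qed.

Lemma sqnorm_le_norm a (B : nat) :
  `|map_mx intr a : 'rV[R]_m| < B%:R -> (sqnorm a <= m * B ^ 2)%N.
Proof.
move=> aB; have H i : true -> (`|a 0%R i| ^ 2 <= B ^ 2)%N.
  move=> _; rewrite leq_exp2r//; apply: ltnW.
  rewrite -(ltr_nat R) natr_absz intr_norm; apply: le_lt_trans aB.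
  by have := coord_le_norm (map_mx intr a) i; rewrite mxE.
by rewrite (leq_trans (leq_sum _ H))// sum_nat_const card_ord.
Qed.

Lemma finite_sqnorm (k : nat) : finite_set [set a | (sqnorm a <= k)%N].
Proof.
pose f (c : 'rV['I_(2 * k).+1]_m) : 'rV[int]_m :=
  \row_i ((c 0 i : nat)%:Z - k%:Z).
apply: (@sub_finite_set _ _ (f @` setT)); last exact/finite_image/finite_finset.
move=> a /= ak; exists (\row_i inord `|a 0 i + k%:Z|) => //.
have ai i : (`|a 0%R i| <= k)%N.
  apply: leq_trans ak; rewrite /sqnorm (bigD1 i)//=.
  rewrite (leq_trans _ (leq_addr _ _))//.
  exact: leq_sqr.
apply/rowP => i; rewrite !mxE inordK.
  by move: (ai i); lia.
by move: (ai i); lia.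
Qed.

End LatticePairing.

(** * Pushing paths towards the origin *)

Section Pushing.
Variables (G : groupType) (X : set G) (lev : G -> nat).
Local Notation below k := [set g | (lev g <= k)%N].

(** Each vertex g at the top level k + 1 is replaced by its pushed copy g t.
    Consecutive vertices of a path have pushed copies that are joined below:
    the hypothesis at g joins g t to h t for a neighbor h = g y.  If h is lower,
    then h t is adjacent to h.  If h is at the top as well, with its own letter
    t', then h t is a lower neighbor of h, so by the previous case, applied
    at h, it is joined to h t'. *)
Lemma push_down k :
  (forall g, lev g = k.+1 -> exists2 t, cayley X 1 t &
     forall y, cayley X 1 y -> (lev (g * y) <= k.+1)%N ->
       joined X (below k) (g * t) (g * y * t)) ->
  forall g h, (lev g <= k)%N -> (lev h <= k)%N ->
    joined X (below k.+1) g h -> joined X (below k) g h.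
Proof.
move=> push g h gk hk gh.
have /choice[T TP] g' : exists t, lev g' = k.+1 -> cayley X 1 t /\
    forall y, cayley X 1 y -> (lev (g' * y) <= k.+1)%N ->
       joined X (below k) (g' * t) (g' * y * t).
  have [/push[t Xt tP]|ng] := pselect (lev g' = k.+1); first by exists t.
  by exists 1.
pose tau g' := if (lev g' <= k)%N then g' else g' * T g'.
have topP x : (lev x <= k.+1)%N -> (lev x <= k)%N = false -> lev x = k.+1.
  by move=> xk1 xk; apply/eqP; rewrite eqn_leq xk1 ltnNge xk.
have top_low x y : cayley X x y -> lev x = k.+1 -> (lev y <= k)%N ->
    joined X (below k) (x * T x) y.
  move=> xy xk yk; have [Tx xP] := TP x xk.
  rewrite -(mulVKg x y) cayley_mulr in xy.
  have := xP (x^-1 * y) xy; rewrite mulVKg => /(_ (leqW yk)) j.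
  apply: (joined_trans j); apply: joined_edge => //.
    by rewrite cayleyC cayley_mulr.
  exact: (joined_memr j).
have tau_edge x y : cayley X x y -> (lev x <= k.+1)%N -> (lev y <= k.+1)%N ->
    joined X (below k) (tau x) (tau y).
  move=> xy xk1 yk1; rewrite /tau.
  case: ifPn => [xk|/negbTE xk]; case: ifPn => [yk|/negbTE yk].
  - exact: joined_edge.
  - apply: joined_sym; apply: top_low => //; first by rewrite cayleyC.
    exact: topP.
  - by apply: top_low => //; exact: topP.
  have [Tx xP] := TP x (topP _ xk1 xk); have [Ty _] := TP y (topP _ yk1 yk).
  rewrite -(mulVKg x y) cayley_mulr in xy.
  have := xP (x^-1 * y) xy; rewrite mulVKg => /(_ yk1) j.
  apply: (joined_trans j); apply: joined_sym.
  apply: top_low; [|exact: topP|exact: (joined_memr j)].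
  by rewrite cayley_mulr.
suff : joined X (below k) (tau g) (tau h) by rewrite /tau gk hk.
have gB : joined X (below k) (tau g) (tau g).
  by apply: joined_refl; rewrite /= /tau gk.
elim: gh {hk} => // x y gx jx xy yk1; apply: (joined_trans jx).
by apply: tau_edge => //; exact: (joined_memr gx).
Qed.

Lemma joined_below k0 : generated X = [set: G] ->
  (forall k, (k0 <= k)%N -> forall g, lev g = k.+1 ->
     exists2 t, cayley X 1 t &
       forall y, cayley X 1 y -> (lev (g * y) <= k.+1)%N ->
         joined X (below k) (g * t) (g * y * t)) ->
  forall g h, (lev g <= k0)%N -> (lev h <= k0)%N -> joined X (below k0) g h.
Proof.
move=> gX push g h gk hk.
have [K jK] : exists K, joined X (below (k0 + K)%N) g h.
  elim: (joined_total g h gX) => [_|x y _ [K jK] xy _].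
    by exists 0; apply: joined_refl; rewrite /= addn0.
  exists (K + lev y)%N; apply: (joined_step _ xy) => /=; last first.
    by rewrite addnA leq_addl.
  by apply: joined_sub jK => z /= zK; rewrite addnA (leq_trans zK)// leq_addr.
elim: K jK => [|K IHK]; first by rewrite addn0.
rewrite addnS => jK; apply: IHK; apply: push_down => //; last 2 first.
- by rewrite (leq_trans gk)// leq_addr.
- by rewrite (leq_trans hk)// leq_addr.
by apply: push; rewrite leq_addr.
Qed.

End Pushing.

(** * Uniform pushing over a compact set of characters *)

Section Criterion.
Variables (R : realType) (G : groupType) (X : set G) (chi : G -> R).
Hypothesis chiM : group_hom chi.
Local Open Scope ring_scope.

Lemma joined_above_min :
  (forall g h, 0 <= chi g -> 0 <= chi h -> joined X [set p | 0 <= chi p] g h) ->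
  forall g h, joined X [set p | Num.min (chi g) (chi h) <= chi p] g h.
Proof.
move=> cchi; have le_case g h : chi g <= chi h ->
    joined X [set p | chi g <= chi p] g h.
  move=> gh; rewrite -{2}(mulg1 g) -(mulVKg g h).
  apply: (@joined_upper_mul _ _ _ _ chiM 0); first by rewrite addr0.
  apply: cchi; first by rewrite (group_hom1 chiM).
  by rewrite chiM (group_homV chiM) addrC subr_ge0.
move=> g h; have [gh|/ltW hg] := leP (chi g) (chi h); first exact: le_case.
exact/joined_sym/le_case.
Qed.

(** The edge from 1 to y is moved by the letter t to a path from t to y t that
    stays higher by chi t.  This condition involves only finitely many
    elements of G, so it persists, with a smaller gain, for characters near
    chi. *)
Lemma push_of_connected t :
  (forall g h, 0 <= chi g -> 0 <= chi h -> joined X [set p | 0 <= chi p] g h) ->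
  forall y, joined X [set p | chi t + Num.min 0 (chi y) <= chi p] t (y * t)%g.
Proof.
move=> cchi y; have := joined_above_min cchi t (y * t)%g.
apply: joined_sub => p /=; apply: le_trans.
by rewrite chiM addr_minr addr0 [chi y + _]addrC.
Qed.

End Criterion.

Section Uniform.
Variables (R : realType) (G : groupType) (X : set G) (m : nat).
Variable al : G -> 'rV[int]_m.
Hypotheses (gX : finite_generating X) (alM : group_hom al).
Local Open Scope ring_scope.
Implicit Type u : 'rV[R]_m.

Local Notation chi u := (fun g => pairing u (al g)).

Lemma pairing_hom u : group_hom (chi u).
Proof. by move=> g h; rewrite alM pairingD. Qed.

(** The number N controls two things at once, the gain of height and the size
    of the region visited by the paths, so that pushability is monotone in N
    and can be made uniform by compactness. *)
Definition pushable (N : nat) u := exists2 t, cayley X 1%g t &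
  forall y, cayley X 1%g y ->
    joined X [set p | Num.min 0 (chi u y) + N.+1%:R^-1 <= chi u p /\
                      (sqnorm (al p) <= N)%N] t (y * t)%g.

Lemma joined_sqnorm_bounded B g h : joined X B g h ->
  exists C, joined X (B `&` [set p | (sqnorm (al p) <= C)%N]) g h.
Proof.
elim=> [Bg|k l _ [C jC] kl Bl].
  by exists (sqnorm (al g)); apply: joined_refl => /=.
exists (maxn C (sqnorm (al l))); apply: (joined_step _ kl) => /=.
  by apply: joined_sub jC => p [Bp /= pC]; split=> //=; rewrite leq_max pC.
by split=> //; rewrite leq_max leqnn orbT.
Qed.

(** If the paths at u0 visit lattice points of square norm at most C and gain
    c, then moving u0 by less than d = c / (4 (C + 1)) changes every height
    involved by at most c / 4, hence the gain remains at least c / 2. *)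
Lemma pushable_near u0 : chi u0 <> cst 0 ->
  (forall g h, 0 <= chi u0 g -> 0 <= chi u0 h ->
     joined X [set p | 0 <= chi u0 p] g h) ->
  \forall u \near u0 & N \near \oo, pushable N u.
Proof.
move=> chi0 cchi; have chiM := pairing_hom u0.
have [t Xt t_gt0] := exists_ascending gX chiM chi0.
set c := pairing u0 (al t) in t_gt0.
have [C CP] : exists C : nat, forall y, cayley X 1%g y ->
    (sqnorm (al y) <= C)%N /\
    joined X ([set p | c + Num.min 0 (chi u0 y) <= chi u0 p] `&`
              [set p | (sqnorm (al p) <= C)%N]) t (y * t)%g.
  have fY : finite_set (X `|` [set x^-1%g | x in X]).
    by rewrite finite_setU; split; [|apply: finite_image]; exact: gX.1.
  have XY y : cayley X 1%g y -> (X `|` [set x^-1%g | x in X]) y.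
    case/orP; rewrite inE ?invg1 ?mul1g ?mulg1 => Xy; first by left.
    by right; exists y^-1%g => //; rewrite invgK.
  have [s sE] := (finite_seqP _).1 fY; rewrite {}sE in XY.
  suff [C sC] : exists C : nat, forall y, y \in s -> 
      (sqnorm (al y) <= C)%N /\
      joined X ([set p | c + Num.min 0 (chi u0 y) <= chi u0 p] `&`
              [set p | (sqnorm (al p) <= C)%N]) t (y * t)%g.
    by exists C => y /XY; apply: sC.
  elim: s {XY} => [|y s [C sC]]; first by exists 0.
  have [C' yC'] := joined_sqnorm_bounded (push_of_connected chiM t cchi y).
  exists (maxn C (maxn C' (sqnorm (al y)))) => z.
  rewrite inE => /predU1P[->|zs].
    split; first by rewrite !leq_max leqnn !orbT.
    apply: joined_sub yC' => p [? /= pC']; split=> //=.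
    by rewrite !leq_max pC' orbT.
  have [zC jz] := sC z zs; split; first by rewrite leq_max zC.
  by apply: joined_sub jz => p [? /= pC]; split=> //=; rewrite leq_max pC.
pose d := c / (4 * C.+1%:R).
have d_gt0 : 0 < d by rewrite divr_gt0// mulr_gt0.
have dC : d * C%:R <= c / 4.
  rewrite /d invfM mulrA -mulrA ler_piMr//; first by rewrite divr_ge0// ltW.
  by rewrite mulrC ler_pdivrMr// mul1r ler_nat.
have unear : \forall u \near u0, `|u0 - u| < d.
  by apply/nbhs_normP; exists d.
have Nnear : \forall N \near \oo, (C <= N)%N /\ N.+1%:R^-1 <= c / 2.
  near=> N; split; first by near: N; exact: nbhs_infty_ge.
  near: N; have := near_infty_natSinv_lt (PosNum (divr_gt0 t_gt0 (ltr0n R 2))).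
  by apply: filterS => N /ltW.
near=> u N.
have ud : `|u0 - u| < d by near: u.
have [CN Nc] : (C <= N)%N /\ N.+1%:R^-1 <= c / 2 by near: N.
have close g : (sqnorm (al g) <= C)%N -> `|chi u0 g - chi u g| <= c / 4.
  move=> gC; rewrite -pairingBl; apply: le_trans (pairing_bound _ _) _.
  apply: le_trans dC; by apply: ler_pM; rewrite ?ler_nat ?ler0n// ltW.
exists t => // y Xy; have [yC jy] := CP y Xy.
apply: joined_sub jy => p [/= pc pC]; split; last exact: leq_trans CN.
have := close y yC; have := close p pC.
rewrite !ler_norml => /andP[p1 p2] /andP[y1 y2].
set mu := Num.min 0 (pairing u _).
have mu0 : mu <= 0 by rewrite ge_min lexx.
have muy : mu <= pairing u (al y) by rewrite ge_min lexx orbT.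
have mu_le : mu - c / 4 <= Num.min 0 (pairing u0 (al y)).
  by rewrite le_min; apply/andP; split; lra.
have lin (e m0 m1 q0 q1 : R) : c + m0 <= q0 -> e <= c / 2 ->
    q0 - q1 <= c / 4 -> m1 - c / 4 <= m0 -> m1 + e <= q1 by lra.
exact: lin pc Nc p2 mu_le.
Unshelve. all: by end_near.
Qed.

Variable S : {set 'I_m}.

(** The characters considered are parametrized by a coordinate subspace; it
    will be the one in which al takes its values. *)
Definition supported : set 'rV[R]_m :=
  [set u | forall i, i \notin S -> u 0 i = 0].

Lemma unit_sphere_compact : compact ([set u | `|u| = 1] `&` supported).
Proof.
apply: bounded_closed_compact.
  exists 1; split; first exact: num_real.
  by move=> M M1 u [/= -> _]; exact: ltW.
apply: closedI.
  apply: (@closed_comp _ _ (fun u : 'rV[R]_m => `|u|) [set 1]) => [u _|].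
    exact: norm_continuous.
  exact: closed_eq.
have -> : supported = \bigcap_(i in [set i | i \notin S]) [set u | u 0 i = 0].
  by apply/seteqP; split=> u uS i; exact: uS.
apply: closed_bigI => i _.
apply: (@closed_comp _ _ (fun u => u 0 i) [set 0]) => [u _|].
  exact: coord_continuous.
exact: closed_eq.
Qed.

Hypothesis chi_neq0 : forall u, supported u -> u != 0 -> chi u <> cst 0.
Hypothesis chi_connected : forall u, supported u -> u != 0 ->
  forall g h, 0 <= chi u g -> 0 <= chi u h ->
    joined X [set p | 0 <= chi u p] g h.

Lemma pushable_uniform :
  exists N, forall u, `|u| = 1 -> supported u -> pushable N u.
Proof.
have /compact_near_coveringP cpt := unit_sphere_compact.
have [|N _ NP] := cpt nat \oo pushable _ _.
  move=> u [/= u1 uS]; have u0 : u != 0 by rewrite -normr_eq0 u1 oner_eq0.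
  by apply: pushable_near; [exact: chi_neq0 | exact: chi_connected].
by exists N => u u1 uS; apply: (NP N) => //=.
Qed.

Hypothesis al_supported : forall g i, i \notin S -> al g 0 i = 0.

(** Let a = al g be large, and let t be the letter for the unit vector opposite
    to a.  If g y is not higher than g then <a, al y> <= 0, so all vertices p
    of the path from t to y t satisfy <a, al p> <= - (N + 1) and
    |al p|^2 <= N.  The square norm |a|^2 + 2 <a, al p> + |al p|^2 of g p is
    therefore less than |a|^2, and paths are pushed down level by level. *)
Lemma joined_sqnorm_below : exists k0, forall g h,
  (sqnorm (al g) <= k0)%N -> (sqnorm (al h) <= k0)%N ->
  joined X [set p | (sqnorm (al p) <= k0)%N] g h.
Proof.
have [N NP] := pushable_uniform.
(* The gain 1 / (N + 1) is measured with unit vectors; for the vector a it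
   becomes |a| / (N + 1), which is at least N + 1 once |a| >= (N + 1)^2. *)
pose B := (N.+1 ^ 2)%N; exists (m * B ^ 2)%N.
apply: (@joined_below _ _ (fun g => sqnorm (al g))); first exact: gX.2.
move=> k k0k g gk.
pose a : 'rV[R]_m := map_mx intr (al g).
have aB : B%:R <= `|a|.
  rewrite leNgt; apply/negP => /sqnorm_le_norm; rewrite gk => /leq_trans.
  by move=> /(_ _ k0k); rewrite ltnn.
have a_gt0 : 0 < `|a| by apply: lt_le_trans aB; rewrite ltr0n expn_gt0.
have [||t Xt tP] := NP (- `|a|^-1 *: a).
- by rewrite normrZ normrN normfV normr_id mulVf// gt_eqF.
- by move=> i iS; rewrite !mxE al_supported// mulr0.
exists t => // y Xy gyk.
rewrite -mulgA; apply: joined_mul (tP y Xy) => p /= [pu pN].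
have pE : pairing (- `|a|^-1 *: a) (al p) * `|a| = - pairing a (al p).
  by rewrite pairingZl mulNr mulNr mulrAC mulVf ?gt_eqF// mul1r.
have yE : pairing (- `|a|^-1 *: a) (al y) * `|a| = - pairing a (al y).
  by rewrite pairingZl mulNr mulNr mulrAC mulVf ?gt_eqF// mul1r.
have y_le0 : pairing a (al y) <= 0.
  move: gyk; rewrite alM -(ler_nat R) sqnormD gk -/a.
  have : 0 <= (sqnorm (al y))%:R :> R by [].
  lra.
have p_le : N.+1%:R <= - pairing a (al p).
  rewrite -pE -ler_pdivrMr//; apply: le_trans pu.
  rewrite min_l; last by rewrite -(pmulr_lge0 _ a_gt0) yE oppr_ge0.
  rewrite add0r ler_pdivrMr// ler_pdivlMl//.
  by apply: le_trans aB; rewrite /B natrX expr2.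
rewrite -ltnS -(ltr_nat R) alM sqnormD gk -/a.
have : (sqnorm (al p))%:R <= N%:R :> R by rewrite ler_nat.
move: p_le; rewrite -natr1; have : 0 <= N%:R :> R by []; lra.
Qed.

(** The hypothesis on K says that each fiber of al meets finitely many cosets
    of K, so that K acts with finitely many orbits on the vertices of a ball,
    which spans a connected graph. *)
Lemma fg_of_connected_half_spaces (K : set G) : is_subgroup K ->
  K `<=` hom_ker al ->
  (forall w, exists2 T, finite_set T &
     forall g, al g = w -> exists2 t, T t & K (g * t^-1)%g) ->
  finitely_generated K.
Proof.
move=> sK Kker fib; have [k0 k0P] := joined_sqnorm_below.
have sq0 : sqnorm (0 : 'rV[int]_m) = 0%N by apply: big1 => i _; rewrite mxE.
have /choice[T TP] w : exists T : set G, finite_set T /\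
    forall g, al g = w -> exists2 t, T t & K (g * t^-1)%g.
  by have [T fT TP] := fib w; exists T.
apply: (@fg_of_connected_orbits _ X K [set g | (sqnorm (al g) <= k0)%N]
  (\bigcup_(w in [set w | (sqnorm w <= k0)%N]) T w)) => //.
- exact: gX.1.
- by move=> g /Kker ag; rewrite /= (ag : al g = 0) sq0.
- by apply: bigcup_finite => [|w _]; [exact: finite_sqnorm | exact: (TP w).1].
- move=> g /= gk; have [t Tt Kt] := (TP (al g)).2 g erefl.
  by exists t => //; exists (al g).
- by move=> g gk; apply: k0P => //; rewrite (group_hom1 alM) sq0.
Qed.

End Uniform.

(** * Coordinates on a finitely generated abelian group *)

Section FiniteRankCoordinates.
Variables (A : zmodType) (m : nat) (x : 'I_m -> A).
Local Open Scope ring_scope.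
Implicit Types (v w : 'rV[int]_m) (S : {set 'I_m}).

Definition comb v : A := \sum_i x i *~ v 0 i.

Lemma combB v w : comb (v - w) = comb v - comb w.
Proof. by rewrite -sumrB; apply: eq_bigr => i _; rewrite !mxE mulrzBr. Qed.

Lemma combD v w : comb (v + w) = comb v + comb w.
Proof. by rewrite -big_split; apply: eq_bigr => i _; rewrite mxE mulrzDr. Qed.

Lemma combZ k v : comb (k *: v) = comb v *~ k.
Proof.
rewrite mulrz_suml; apply: eq_bigr => i _.
by rewrite mxE mulrzA mulrzAC.
Qed.

Lemma comb_delta i : comb (delta_mx 0 i) = x i.
Proof.
rewrite /comb (bigD1 i)//= mxE !eqxx/= big1 ?addr0// => j ji.
by rewrite mxE (negbTE ji) andbF.
Qed.

Definition int_supported S : set 'rV[int]_m :=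
  [set v | forall i, i \notin S -> v 0 i = 0].

Definition independent S :=
  forall v, int_supported S v -> comb v = 0 -> v = 0.

Lemma int_supportedD S v w :
  int_supported S v -> int_supported S w -> int_supported S (v + w).
Proof. by move=> vS wS i iS; rewrite mxE vS// wS// addr0. Qed.

Lemma int_supportedB S v w :
  int_supported S v -> int_supported S w -> int_supported S (v - w).
Proof. by move=> vS wS i iS; rewrite !mxE vS// wS// subr0. Qed.

Lemma int_supportedZ S k v : int_supported S v -> int_supported S (k *: v).
Proof. by move=> vS i iS; rewrite mxE vS// mulr0. Qed.

(** For a maximal independent set S of generators, the addition of any further
    generator x j creates a relation, in which x j has a nonzero
    coefficient. *)
Lemma maximal_independent : exists2 S, independent S &
  forall j, exists2 d : nat, (0 < d)%N &
    exists2 s, int_supported S s & x j *+ d = comb s.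
Proof.
have [|S /maxsetP[/asboolP indS maxS]] :=
    @ex_maxset _ (fun S => `[< independent S >]).
  exists finset.set0; apply/asboolP => v v0 _; apply/rowP => i.
  by rewrite v0 ?mxE// finset.in_set0.
exists S => // j; have [jS|jS] := boolP (j \in S).
  exists 1%N => //; exists (delta_mx 0 j); last by rewrite comb_delta.
  by move=> i iS; rewrite mxE eqxx; case: eqP iS => //= ->; rewrite jS.
have /existsNP[v /not_implyP[vS /not_implyP[v0 vN0]]] :
    ~ independent (j |: S)%SET.
  move=> ind; move/negP: jS; apply.
  rewrite -(maxS (j |: S)%SET) ?finset.setU11 ?finset.subsetUr//.
  exact/asboolP.
have vj0 : v 0 j != 0.
  apply: contra_notN vN0 => /eqP vj; apply: indS => // i iS.
  by have [->//|ij] := eqVneq i j; apply: vS; rewrite !inE negb_or ij.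
exists `|v 0%R j|%N; first by rewrite absz_gt0.
exists (sgz (v 0 j) *: (v 0 j *: delta_mx 0 j - v)).
  apply: int_supportedZ => i iS; rewrite !mxE eqxx/=.
  have [->|ij] := eqVneq i j; first by rewrite mulr1 subrr.
  by rewrite mulr0 vS ?subr0// !inE negb_or ij.
rewrite combZ combB combZ comb_delta v0 subr0 -mulrzA pmulrn.
by rewrite abszEsg mulrC.
Qed.

Hypothesis x_span : forall a, exists v, a = comb v.

(** A common multiple d of the denominators makes d A a subgroup of the free
    abelian group on the generators of S, and be is multiplication by d
    followed by coordinates there. *)
Lemma finite_rank_coordinates : exists d S (be : A -> 'rV[int]_m),
  [/\ (0 < d)%N, {morph be : a b / a + b}, forall a, int_supported S (be a),
      forall i, i \in S -> be (x i) = delta_mx 0 i *+ d &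
      forall a, a *+ d = comb (be a)].
Proof.
have [S indS xS] := maximal_independent.
have /choice[e eP] j : exists p : nat * 'rV[int]_m,
    [/\ (0 < p.1)%N, int_supported S p.2 & x j *+ p.1 = comb p.2].
  by have [d d0 [s sS xd]] := xS j; exists (d, s).
pose d := (\prod_j (e j).1)%N.
pose f j := (\prod_(i | i != j) (e i).1)%N%:Z *: (e j).2.
have fS j : int_supported S (f j) by apply: int_supportedZ; case: (eP j).
have xd j : x j *+ d = comb (f j).
  rewrite combZ -pmulrn; have [_ _ <-] := eP j.
  by rewrite -mulrnA /d (bigD1 j).
have /choice[be beP] a : exists s, int_supported S s /\ a *+ d = comb s.
  have [v ->] := x_span a; exists (\sum_j v 0 j *: f j); split.
    move=> i iS; rewrite summxE big1// => j _.
    by rewrite mxE fS// mulr0.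
  rewrite (big_morph comb combD (_ : comb 0 = 0)); last first.
    by have := combB 0 0; rewrite !subrr.
  rewrite {1}/comb -sumrMnl; apply: eq_bigr => j _.
  by rewrite combZ -xd !pmulrn mulrzAC.
have be_unique a s : int_supported S s -> a *+ d = comb s -> be a = s.
  move=> sS as_; apply/eqP; rewrite -subr_eq0; apply/eqP/indS.
    by apply: int_supportedB => //; case: (beP a).
  by rewrite combB -as_; case: (beP a) => _ <-; rewrite subrr.
exists d, S, be; split.
- by apply: prodn_gt0 => j; case: (eP j).
- move=> a b; apply: be_unique.
    by apply: int_supportedD; [case: (beP a) | case: (beP b)].
  by rewrite combD mulrnDl; case: (beP a) => _ <-; case: (beP b) => _ <-.
- by move=> a; case: (beP a).
- move=> i iS; apply: be_unique; last first.
    by rewrite -scaler_nat combZ comb_delta pmulrn natz.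
  move=> j jS; rewrite mulmxnE mxE eqxx.
  case: eqP jS => [->|_ _]; rewrite ?iS//=.
  by rewrite mul0rn.
- by move=> a; case: (beP a).
Qed.

(** Dividing the coefficients of a by d with remainder gives
    a = comb b + d (comb c) = comb b + comb (be (comb c)) with b in a finite
    box, and be a = be (comb b) + d (be (comb c)) shows that be a and b
    determine a. *)
Lemma finite_fibers d (be : A -> 'rV[int]_m) : (0 < d)%N ->
  {morph be : a b / a + b} -> (forall a, a *+ d = comb (be a)) ->
  forall w, finite_set [set a | be a = w].
Proof.
move=> d_gt0 beD beE w.
have be0 : be 0 = 0 by apply: (addrI (be 0)); rewrite -beD !addr0.
have beMn a n : be (a *+ n) = be a *+ n.
  by elim: n => [|n IHn]; rewrite ?be0// !mulrS beD IHn.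
pose F (b : 'rV[int]_m) := comb b +
  comb (\row_i divz ((w - be (comb b)) 0 i) d).
pose box := [set b : 'rV[int]_m | (sqnorm b <= m * d ^ 2)%N].
apply: (@sub_finite_set _ _ (F @` box)); last first.
  exact/finite_image/finite_sqnorm.
move=> a /= aw; have [v av] := x_span a.
pose b : 'rV[int]_m := \row_i modz (v 0 i) d.
pose c : 'rV[int]_m := \row_i divz (v 0 i) d.
have vE : v = b + d%:Z *: c.
  by apply/rowP => i; rewrite !mxE addrC mulrC -divz_eq.
have aE : a = comb b + comb c *+ d by rewrite av vE combD combZ pmulrn.
exists b.
  rewrite /box/=; apply: (@leq_trans (\sum_(i < m) d ^ 2)%N); last first.
    by rewrite sum_nat_const card_ord.
  apply: leq_sum => i _; rewrite leq_exp2r// mxE.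
  have : 0 <= modz (v 0 i) d by apply: modz_ge0; rewrite eqz_nat -lt0n.
  have : modz (v 0 i) d < d%:Z by apply: ltz_pmod; rewrite ltz_nat.
  lia.
rewrite /F [RHS]aE beE; congr (_ + comb _); apply/rowP => i.
rewrite mxE -aw aE beD beMn addrC addKr mulmxnE -mulr_natr natz mulzK//.
by rewrite eqz_nat -lt0n.
Qed.

End FiniteRankCoordinates.

(** * Discrete characters *)

Section Discrete.
Variables (R : realType) (G : groupType).
Local Open Scope ring_scope.

(** A discrete subgroup of the line has a least positive element c, and
    rounding chi g / c down gives the integral character. *)
Lemma discrete_hom_int (chi : G -> R) : group_hom chi -> chi <> cst 0 ->
  discrete_hom chi -> exists2 c : R, c != 0 & exists2 al : G -> int,
    group_hom al & forall g, chi g = c * (al g)%:~R.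
Proof.
move=> chiM chi0 chid.
have [|_ [V /nbhs_ballP[e /= e_gt0 eV] Vrange]] := chid 0.
  by exists 1%g => //; apply: group_hom1.
have gap g : `|chi g| < e -> chi g = 0.
  move=> ge; have : (V `&` range chi) (chi g).
    by split; [apply: eV; rewrite -ball_normE/= sub0r normrN | exists g].
  by rewrite Vrange.
(* For the least n such that chi takes a positive value below (n + 1) e, all
   these values lie in an interval of length e, so there is only one. *)
have exP : exists n : nat, `[< exists2 g, 0 < chi g & chi g < n.+1%:R * e >].
  have [g g_gt0] : exists g, 0 < chi g.
    apply: contrapT => ng; apply: chi0; apply/funext => g /=.
    apply/eqP; rewrite eq_le !leNgt; apply/andP; split; apply/negP => g_gt0.
      by apply: ng; exists g.
    by apply: ng; exists g^-1%g; rewrite (group_homV chiM) oppr_gt0.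
  exists (Num.bound (chi g / e)); apply/asboolP; exists g => //.
  rewrite -ltr_pdivrMr//; apply: lt_trans (_ : (Num.bound (chi g / e))%:R < _).
    by apply: archi_boundP; rewrite divr_ge0// ltW.
  by rewrite ltr_nat.
have [n /asboolP[g0 g0_gt0 g0n] nmin] := ex_minnP exP.
pose c := chi g0.
have no_small h : 0 < chi h -> c <= chi h.
  move=> h_gt0; rewrite leNgt; apply/negP => hc.
  have nh : n%:R * e <= chi h.
    rewrite leNgt; apply/negP => hn.
    case: n nmin g0n hn => [|n] nmin g0n hn.
      by move: h_gt0; rewrite ltNge ltW// -[0](mul0r e).
    have := nmin n; rewrite ltnn => /(_ _)/negP; apply; last by [].
    by apply/asboolP; exists h.
  have := gap (g0 * h^-1)%g; rewrite (group_homF chiM) gtr0_norm ?subr_gt0//.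
  move: g0n nh; rewrite -natr1 mulrDl mul1r => g0n nh /(_ _)/eqP.
  rewrite subr_eq0 gt_eqF// => H; suff : false by [].
  by apply: H; rewrite ltrBlDl; apply: lt_le_trans g0n _; rewrite lerD2r.
have cE g : chi g = c * (Num.floor (chi g / c))%:~R.
  have sT : is_subgroup [set: G] by [].
  have [h _ hE] :=
    hom_subgroup_mulz chiM (Num.floor (chi g / c)) sT (I : setT g0).
  rewrite mulrzr -hE; apply/eqP; rewrite -subr_eq0 -(group_homF chiM).
  have /andP[lo hi] := floor_itv (chi g / c).
  have r_ge0 : 0 <= chi (g * h^-1)%g.
    rewrite (group_homF chiM) subr_ge0 hE -mulrzr mulrC.
    by rewrite -ler_pdivlMr.
  have r_lt : chi (g * h^-1)%g < c.
    rewrite (group_homF chiM) ltrBlDr hE -mulrzr -/c [c + _]addrC [c * _]mulrC.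
    rewrite -[X in _ + X]mul1r -mulrDl -ltr_pdivrMr//.
    by move: hi; rewrite intrD.
  rewrite eq_le r_ge0 andbT leNgt; apply/negP => /no_small.
  by rewrite leNgt r_lt.
have c0 : c != 0 by rewrite gt_eqF.
exists c => //; exists (fun g => Num.floor (chi g / c)) => // g h.
apply: (@intr_inj R); apply: (mulfI c0).
by rewrite intrD mulrDr -!cE chiM.
Qed.

Lemma int_hom_discrete (r : R) (al : G -> int) : group_hom al ->
  discrete_hom (fun g => r * (al g)%:~R).
Proof.
move=> alM _ [g _ <-]; split; first by apply/mem_set; exists g.
have [->|r0] := eqVneq r 0.
  exists setT; first exact: filterT.
  rewrite setTI mul0r.
  apply/seteqP; split=> [_ [h _ <-]|_ ->]; rewrite ?mul0r//.
  by exists g => //; rewrite mul0r.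
exists (ball (r * (al g)%:~R) `|r|).
  by apply: nbhsx_ballx; rewrite normr_gt0.
apply/seteqP; split=> [y [yb [h _ yE]]|_ ->]; last first.
  by split; [apply: ballxx; rewrite normr_gt0 | exists g].
move: yb; rewrite -{y}yE -ball_normE /= -mulrBr normrM -[ltRHS]mulr1.
rewrite ltr_pM2l ?normr_gt0// -intrB -intr_norm -[1]/(1%:~R) ltr_int.
by move=> /= lt1; congr (_ * _%:~R); lia.
Qed.

End Discrete.

(** * The invariant Sigma1 and kernels *)

Section Sigma.
Variables (R : realType) (G : groupType) (X : set G).
Hypothesis gX : finite_generating X.
Local Open Scope ring_scope.

Lemma Sigma1_rayP (chi : G -> R) : nonzero_hom R G chi ->
  Sigma1 R X (ray chi) <->
  forall g h, 0 <= chi g -> 0 <= chi h -> joined X [set p | 0 <= chi p] g h.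
Proof.
have P (psi : G -> R) : connected_on (cayley X) [pred g | 0 <= psi g] <->
    forall g h, 0 <= psi g -> 0 <= psi h -> joined X [set p | 0 <= psi p] g h.
  exact: connected_onP.
move=> chi0; split=> [[psi [_ /P cpsi] psichi]|cchi]; last first.
  by exists chi => //; split=> //; apply/P.
have : ray chi chi.
  by exists 1 => /=; [exact: ltr01 | apply/funext => g; rewrite mul1r].
rewrite -psichi => -[r /= r_gt0 chiE].
have sgnE g : (0 <= chi g) = (0 <= psi g) by rewrite -chiE pmulr_rge0.
move=> g h; rewrite !sgnE => g0 h0.
by apply: joined_sub (cpsi g h g0 h0) => p /=; rewrite sgnE.
Qed.

Lemma Sigma1_of_fg_ker (chi : G -> R) : nonzero_hom R G chi ->
  finitely_generated (hom_ker chi) -> Sigma1 R X (ray chi).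
Proof.
move=> chiN fgk; have [chiM chi0] := chiN; apply/Sigma1_rayP => // g h g0 h0.
have J := connected_of_fg_ker gX chiM chi0 fgk.
by apply: (joined_trans (joined_sym (J g g0))); exact: J.
Qed.

Lemma SQ_sub_Sigma1 :
  (forall al : G -> int, group_hom al -> finitely_generated (hom_ker al)) ->
  SQ R G `<=` Sigma1 R X.
Proof.
move=> fgk _ [chi [chiN chid] <-]; apply: Sigma1_of_fg_ker => //.
have [chiM chi0] := chiN.
have [c c0 [al alM alE]] := discrete_hom_int chiM chi0 chid.
suff -> : hom_ker chi = hom_ker al by apply: fgk.
apply/seteqP; split=> g; rewrite /hom_ker/= alE.
  by move/eqP; rewrite mulf_eq0 (negbTE c0)/= intr_eq0 => /eqP.
by move=> ->; rewrite mulr0.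
Qed.

(** Up to positive multiples, the characters involved are just al and its
    opposite, seen as characters through the lattice of rank one. *)
Lemma fg_ker_of_SQ_sub : SQ R G `<=` Sigma1 R X ->
  forall al : G -> int, group_hom al -> finitely_generated (hom_ker al).
Proof.
move=> SQS al alM.
have [al0|/existsNP[g1 g1_neq0]] := pselect (forall g, al g = 0).
  suff -> : hom_ker al = [set: G] by exists X; [exact: gX.1 | rewrite gX.2].
  by apply/seteqP; split=> // g _; exact: al0.
pose al1 g : 'rV[int]_1 := const_mx (al g).
have al1M : group_hom al1 by move=> g h; apply/rowP => i; rewrite !mxE alM.
have pE (u : 'rV[R]_1) g : pairing u (al1 g) = u 0 0 * (al g)%:~R.
  by rewrite /pairing big_ord1 mxE.
have chiN (u : 'rV[R]_1) : u != 0 ->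
    nonzero_hom R G (fun g => pairing u (al1 g)).
  move=> u0; split; first exact: pairing_hom.
  move=> /(congr1 (fun f => f g1)) /=; rewrite pE => /eqP.
  rewrite mulf_eq0 intr_eq0 => /orP[/eqP u00|/eqP//].
  by case/eqP: u0; apply/rowP => i; rewrite mxE ord1.
suff kE : hom_ker al = hom_ker al1.
  rewrite kE.
  apply: (@fg_of_connected_half_spaces R _ X _ al1 gX al1M finset.setT).
  - by move=> u _ u0; have [] := chiN u u0.
  - move=> u _ u0; apply/(Sigma1_rayP (chiN u u0))/SQS.
    exists (fun g => pairing u (al1 g)) => //; split; first exact: chiN.
    rewrite /= (_ : (fun g => _) = fun g => u 0 0 * (al g)%:~R); last first.
      by apply/funext => g; rewrite pE.
    exact: int_hom_discrete.
  - by move=> g i; rewrite finset.in_setT.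
  - exact: hom_ker_subgroup.
  - by [].
  - move=> w; have [[t tw]|nt] := pselect (exists t, al1 t = w); last first.
      by exists set0 => // g gw; case: nt; exists g.
    exists [set t] => // g gw; exists t => //.
    by rewrite /hom_ker/= (group_homF al1M) gw tw subrr.
apply/seteqP; split=> g; rewrite /hom_ker/=.
  by move=> ag; apply/rowP => i; rewrite !mxE.
by move=> /rowP/(_ 0); rewrite !mxE.
Qed.

End Sigma.

(** The coordinates of the abelianization, pulled back to G.  Its torsion is
    finite, which is why fibers meet finitely many cosets of the derived
    subgroup. *)
Lemma coordinates_mod_derived (G : groupType) (s : seq G) :
  generated [set` s] = [set: G] ->
  exists m S d (al : G -> 'rV[int]_m.+1),
  [/\ (0 < d)%N, group_hom al, forall g, int_supported S (al g),
      forall i, i \in S -> exists g, al g = (delta_mx 0 i *+ d)%R &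
      (forall g, al g = 0%R -> derived_subgroup G (g ^+ d)) /\
      forall w, exists2 T, finite_set T & forall g, al g = w ->
        exists2 t, T t & derived_subgroup G (g * t^-1)].
Proof.
move=> gs; pose t := (0%R : abelianization G) :: map (@ab G) s.
pose x (i : 'I_(size (map (@ab G) s)).+1) := (t`_i)%R.
have xspan a : exists v, a = comb x v.
  have [|v vE] := @ZspanP _ t a.
    exists 0%R; rewrite mul0rz subr0 -(abK a).
    by apply: hom_Zspan => //; exact: ab_hom.
  exists (\row_i v i)%R; rewrite vE /comb.
  by apply: eq_bigr => i _; rewrite mxE.
have [d [S [be [d_gt0 beD beS bex bed]]]] := finite_rank_coordinates xspan.
have alM : group_hom (be \o @ab G) by move=> g h; rewrite /= ab_hom beD.
exists _, S, d, (be \o @ab G); split=> //; first by move=> g; exact: beS.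
  by move=> i iS; exists (repr (x i)); rewrite /= abK bex.
split=> [g g0|w].
  rewrite -hom_ker_ab /hom_ker/= (group_homX (@ab_hom G)) bed.
  rewrite [be _]g0; have := combB x 0 0; rewrite !subrr; exact.
exists ((@repr _ _) @` [set a : abelianization G | be a = w]).
  by apply: finite_image; exact: finite_fibers d_gt0 beD bed w.
move=> g gw; exists (repr (ab g)); first by exists (ab g).
by apply/ab_eqP; rewrite abK.
Qed.

Section Derived.
Variables (R : realType) (G : groupType) (X : set G).
Hypothesis gX : finite_generating X.
Local Open Scope ring_scope.

Lemma finite_generating_seq : exists s : seq G, generated [set` s] = [set: G].
Proof. by have [/finite_seqP[s sE] gXT] := gX; exists s; rewrite -sE. Qed.

Lemma fg_setT : finitely_generated [set: G].
Proof. by exists X; [exact: gX.1 | rewrite gX.2]. Qed.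

Lemma Sigma1_sub_sphere : Sigma1 R X `<=` character_sphere R G.
Proof. by move=> _ [chi [chiN _] <-]; exists chi. Qed.

(** The linear forms on the coordinates of the abelianization are nonzero
    characters, because the coordinates take the value d e_i for i in S. *)
Lemma fg_derived_of_Sigma1 : Sigma1 R X = character_sphere R G ->
  finitely_generated (derived_subgroup G).
Proof.
move=> SE; have [s gs] := finite_generating_seq.
have [m [S [d [al [d_gt0 alM alS alx [_ fib]]]]]] := coordinates_mod_derived gs.
have chiN (u : 'rV[R]_m.+1) : supported S u -> u != 0 ->
    nonzero_hom R G (fun g => pairing u (al g)).
  move=> uS u0; split; first exact: pairing_hom.
  move=> chi0; case/eqP: u0; apply/rowP => i; rewrite mxE.
  have [/alx[g gE]|/uS//] := boolP (i \in S).
  have := congr1 (fun f => f g) chi0; rewrite /= gE /pairing.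
  rewrite (bigD1 i)//= big1 ?addr0 => [|j ji]; last first.
    by rewrite mulmxnE mxE (negbTE ji) andbF mul0rn mulr0.
  rewrite mulmxnE mxE !eqxx/= => /eqP; rewrite mulf_eq0 => /orP[/eqP//|].
  by rewrite intr_eq0 mulrn_eq0 eqn0Ngt d_gt0.
apply: (@fg_of_connected_half_spaces R _ X _ al gX alM S) => //.
- by move=> u uS u0; have [] := chiN u uS u0.
- move=> u uS u0; apply/(Sigma1_rayP X (chiN u uS u0)).
  by rewrite SE; exists (fun g => pairing u (al g)) => //; exact: chiN.
- exact: derived_subgroupP.
- exact: derived_sub_hom_ker.
Qed.

Lemma Sigma1_eq_sphere :
  (forall chi, nonzero_hom R G chi -> finitely_generated (hom_ker chi)) ->
  Sigma1 R X = character_sphere R G.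
Proof.
move=> fgk; apply/seteqP; split; first exact: Sigma1_sub_sphere.
by move=> _ [chi chiN <-]; apply: Sigma1_of_fg_ker => //; exact: fgk.
Qed.

(** The coordinates al of the abelianization modulo torsion satisfy
    ker al <= ker chi for every real character chi. *)
Lemma Sigma1_of_fg_int_ker :
  (forall m (f : G -> 'rV[int]_m.+1), group_hom f ->
     finitely_generated (hom_ker f)) ->
  Sigma1 R X = character_sphere R G.
Proof.
move=> fgk; apply: Sigma1_eq_sphere => chi [chiM _].
have [s gs] := finite_generating_seq.
have [m [S [d [al [d_gt0 alM _ _ [alker _]]]]]] := coordinates_mod_derived gs.
apply: (fg_overgroup_hom_ker alM fg_setT); last exact: fgk.
  exact: hom_ker_subgroup.
move=> g /alker/(derived_sub_hom_ker chiM).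
rewrite /hom_ker/= (group_homX chiM) => /eqP.
by rewrite mulrn_eq0 eqn0Ngt d_gt0 => /eqP.
Qed.

End Derived.

Lemma Zspan_int (v : int) : Zspan [:: 1%R] v.
Proof. by exists v => /=; rewrite intz subrr. Qed.

Lemma Zspan_row m (v : 'rV[int]_m) :
  Zspan [seq delta_mx 0%R i | i <- enum 'I_m] v.
Proof.
rewrite [v]row_sum_delta.
have mulS (s : seq 'rV[int]_m) a (k : int) : Zspan s a -> Zspan s (k *: a)%R.
  move=> sa; rewrite -[k]intz scaler_int.
  by apply: subset_mulz => //; [exact: Zspan0 | exact: ZspanB].
set s := map _ _.
have D a b : Zspan s a -> Zspan s b -> Zspan s (a + b)%R.
  move=> sa sb; rewrite -[b]opprK -[(- b)%R]add0r.
  by apply: ZspanB => //; apply: ZspanB => //; exact: Zspan0.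
apply: (big_ind (Zspan s)) => //; first exact: Zspan0.
by move=> i _; apply/mulS/mem_Zspan; apply: map_f; rewrite mem_enum.
Qed.

(** * Fixed subgroups in the product with a free abelian group *)

Theorem theorem3p7 (R : realType) (G : groupType)
    (Gcenterless : centerless G) (GwH : weakly_Howson G) :
  (* (1) *)
  ((FGFPa (G * Algebra.to_multiplicative int)%type <->
      (FGFPa G /\
       forall X : set G, finite_generating X -> SQ R G `<=` Sigma1 R X)) /\
   (forall X : set G, finite_generating X ->
      (SQ R G `<=` Sigma1 R X <->
       forall alpha : G -> int,
         group_hom alpha -> finitely_generated (hom_ker alpha)))) /\
  (* (2) *)
  (((forall m : nat, (1 <= m)%N ->
       FGFPa (G * Algebra.to_multiplicative 'rV[int]_m)%type) <->
      (FGFPa G /\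
       forall X : set G, finite_generating X ->
         Sigma1 R X = character_sphere R G)) /\
   (forall X : set G, finite_generating X ->
      (Sigma1 R X = character_sphere R G <->
       finitely_generated (derived_subgroup G)))).
Proof.
have exX : FGFPa G -> exists X : set G, finite_generating X.
  by move=> /FGFPa_fg[X fX gX]; exists X.
have part1 X : finite_generating X -> (SQ R G `<=` Sigma1 R X <->
    forall alpha : G -> int,
      group_hom alpha -> finitely_generated (hom_ker alpha)).
  by move=> gX; split; [exact: fg_ker_of_SQ_sub | exact: SQ_sub_Sigma1].
have part2 X : finite_generating X -> (Sigma1 R X = character_sphere R G <->
    finitely_generated (derived_subgroup G)).
  move=> gX; split; first exact: fg_derived_of_Sigma1.
  move=> fgD; apply: Sigma1_eq_sphere => // chi [chiM _].
  by apply: fg_hom_ker_of_derived => //; exact: fg_setT gX.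
split; split=> //; split.
- move=> fgGZ; split; first exact: FGFPa_factor fgGZ.
  move=> X gX; apply/(part1 X gX) => al alM.
  exact: fg_hom_ker_of_FGFPa fgGZ alM.
- move=> [fgG SQS]; have [X gX] := exX fgG.
  apply: (@FGFPa_prod _ _ [:: 1%R]) => //; first exact: Zspan_int.
  exact/(part1 X gX)/SQS.
- move=> fgGZ; have fgG : FGFPa G := FGFPa_factor (fgGZ 1%N isT).
  split=> // X gX; apply: Sigma1_of_fg_int_ker => // m f fM.
  exact: fg_hom_ker_of_FGFPa (fgGZ m.+1 isT) fM.
- move=> [fgG SE] m _; have [X gX] := exX fgG.
  apply: (FGFPa_prod Gcenterless GwH fgG (@Zspan_row m)) => f fM.
  apply: fg_hom_ker_of_derived => //; first exact: fg_setT gX.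
  exact/(part2 X gX)/SE.
Qed.
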